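(* Let $X$ be a separable infinite-dimensional Banach space, let $I$ be an infinite index set, and for each $\alpha\in I$ let $(\tilde x_i^\alpha)_{i=1}^\infty$ be a spreading model of $X$ generated by a normalized weakly null sequence in $X$. For $A\subseteq I$ define the (subsymmetric) norm $R_A$ on $c_{00}$ by $$R_A\big((a_i)\big)=\sup_{\alpha\in A}\Big\|\sum_i a_i\tilde x_i^\alpha\Big\|.$$ Suppose that for every non-empty finite set $F\subseteq I$ the norms $R_I$ and $R_F$ are not equivalent on $c_{00}$ (i.e. there is no $C<\infty$ with $R_I\le C R_F$ on $c_{00}$). Then $(SP_w(X),\le)$ contains an infinite strictly increasing sequence $[(\tilde y^1_i)]<[(\tilde y^2_i)]<[(\tilde y^3_i)]<\cdots$.
   Context: $c_{00}$ denotes the space of finitely supported real sequences. A normalized basic sequence $(x_i)$ in a Banach space $X$ generates a spreading model $(\tilde x_i)$ (a basic sequence in some Banach space) if there exist $\varepsilon_n\downarrow 0$ such that for all $n\in\mathbb N$, all $(a_i)_{i=1}^n\subseteq[-1,1]$ and all $n\le k_1<\cdots<k_n$, $$(1+\varepsilon_n)^{-1}\Big\|\sum_{i=1}^n a_i\tilde x_i\Big\|\le\Big\|\sum_{i=1}^n a_ix_{k_i}\Big\|\le(1+\varepsilon_n)\Big\|\sum_{i=1}^n a_i\tilde x_i\Big\|.$$ For sequences $(u_i),(v_i)$, $(v_i)$ $C$-dominates $(u_i)$ if $\|\sum a_iu_i\|\le C\|\sum a_iv_i\|$ for all $(a_i)\in c_{00}$; $(v_i)$ dominates $(u_i)$ if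 it $C$-dominates it for some $C<\infty$; they are equivalent if each dominates the other. $SP_w(X)$ is the set of equivalence classes $[(\tilde x_i)]$ of spreading models generated by normalized weakly null sequences in $X$, partially ordered by $[(\tilde x_i)]\le[(\tilde y_i)]$ iff $(\tilde y_i)$ dominates $(\tilde x_i)$; $<$ means $\le$ and not equivalent. *)

(* Defs.v *)
From HB Require Import structures.
From mathcomp Require Import all_boot all_order all_algebra.
From mathcomp Require Import all_classical all_reals all_analysis.
Set Implicit Arguments. Unset Strict Implicit. Unset Printing Implicit Defensive.
Import Order.TTheory GRing.Theory Num.Theory.
Import numFieldNormedType.Exports.
Local Open Scope classical_set_scope.
Local Open Scope ring_scope.

(* Elements of c_00 are represented by finite lists a = [a_1; ...; a_n];
   sequences are 0-indexed: x 0 is the paper's x_1. *)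
Definition comb {R : realType} {V : normedModType R} (x : nat -> V) (a : seq R) : V :=
  \sum_(i < size a) a`_i *: x i.

Definition separable {R : realType} (X : normedModType R) : Prop :=
  exists D : set X, countable D /\ dense D.

Definition infinite_dimensional {R : realType} (X : normedModType R) : Prop :=
  ~ exists s : seq X, forall y : X, exists c : nat -> R,
      y = \sum_(i < size s) c i *: s`_i.

Definition is_linear_functional {R : realType} (X : normedModType R)
  (f : X -> R) : Prop :=
  forall (c : R) (u v : X), f (c *: u + v) = c * f u + f v.

Definition weakly_null {R : realType} (X : normedModType R) (x : nat -> X) : Prop :=
  forall f : X -> R, is_linear_functional f -> continuous f ->
    (fun n => f (x n)) @ \oo --> (0 : R).

Definition normalized {R : realType} (X : normedModType R) (x : nat -> X) : Prop :=
  forall n, `|x n| = 1.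

Definition span_seq {R : realType} (X : normedModType R) (x : nat -> X) : set X :=
  [set y | exists (n : nat) (a : nat -> R), y = \sum_(i < n) a i *: x i].

Definition basic_seq {R : realType} (X : normedModType R) (x : nat -> X) : Prop :=
  forall y, closure (span_seq x) y ->
    exists! a : nat -> R, (fun n => \sum_(i < n) a i *: x i) @ \oo --> y.

Definition generates_spreading_model {R : realType} (X Y : normedModType R)
  (x : nat -> X) (xt : nat -> Y) : Prop :=
  normalized x /\ basic_seq x /\ basic_seq xt /\
  exists eps : nat -> R,
    {homo eps : m n / (m <= n)%N >-> n <= m} /\ eps @ \oo --> (0 : R) /\
    forall (n : nat) (a : seq R) (k : nat -> nat),
      size a = n ->
      (forall i, (i < n)%N -> -1 <= a`_i <= 1) ->
      (* paper indices k_1 < ... < k_n with n <= k_1; here k_{i+1} = (k i).+1 *)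
      (n <= (k 0%N).+1)%N ->
      (forall i, (i.+1 < n)%N -> (k i < k i.+1)%N) ->
      (1 + eps n)^-1 * `|comb xt a| <= `|comb (fun i => x (k i)) a| /\
      `|comb (fun i => x (k i)) a| <= (1 + eps n) * `|comb xt a|.

Definition weakly_null_spreading_model {R : realType} (X Y : normedModType R)
  (xt : nat -> Y) : Prop :=
  exists x : nat -> X, weakly_null x /\ generates_spreading_model x xt.

Definition dominates {R : realType} (U V : normedModType R)
  (v : nat -> V) (u : nat -> U) : Prop :=
  exists C : R, forall a : seq R, `|comb u a| <= C * `|comb v a|.

Definition sp_lt {R : realType} (U V : normedModType R)
  (u : nat -> U) (v : nat -> V) : Prop :=
  dominates v u /\ ~ dominates u v.

Definition R_norm {R : realType} (I : Type) (Y : I -> normedModType R)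
  (xt : forall alpha, nat -> Y alpha) (A : set I) (a : seq R) : \bar R :=
  ereal_sup [set (`|comb (xt alpha) a|)%:E | alpha in A].

(* Main.v *)
(** Fix a non-principal ultrafilter U on the integers. For a bounded family v
along an ultrafilter V, the iterated limit over V of |a_1 v(j_1) + ... + a_n v(j_n)|
is a seminorm on c_00, and it can only decrease when the coefficient of a weakly
null term is replaced by 0: a convex continuous function has a continuous affine
minorant touching it at a given point. Diagonal extraction along V turns this
seminorm into the norm of a spreading model.

The non-equivalence of R_I with every R_F yields indices alpha_n, lists a_n and
rapidly decreasing weights w_n > 0 such that |a_n| in the alpha_n-th model exceeds
(n / w_n) times its value in the models alpha_m, m < n, while the weights after w_n
are too small to see a_n. For a set A of integers, the block vectors
sum_(m in A) w_m x^(alpha_m)_(l_m), with l_0 < l_1 < ... taken successively along U,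
are weakly null and give a spreading model, whose norm increases with A by dropping
terms, dominates w_m times the alpha_m-th model for m in A, and is small on a_n when
n is not in A. An increasing sequence of sets A_k with infinite successive
differences therefore gives a strictly increasing sequence of spreading models. *)

Require Import Defs.
From HB Require Import structures.
From mathcomp Require Import all_boot all_order all_algebra.
From mathcomp Require Import all_classical all_reals all_analysis.
From mathcomp Require Import ring lra.
Import Order.TTheory GRing.Theory Num.Theory.
Import numFieldNormedType.Exports.
Local Open Scope classical_set_scope.
Local Open Scope ring_scope.
Set Implicit Arguments. Unset Strict Implicit. Unset Printing Implicit Defensive.

(** * Convex functionals have linear minorants *)

(** Two obstacles shape the proof. Weak nullity concerns uncountably many functionals, so it does
    not pass by itself from an ultrafilter to a sequence extracted from it. It passes here because
    the weights are geometric: a functional is uniformly small on all blocks whose indices are large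
    enough, and the p-th extracted block is required to have all its indices at least p. Secondly,
    model norms of families over different index types must be compared without loss of constants.
    Testing against all convex Lipschitz functionals reduces this to an inequality in one variable,
    since this class is stable under translation and under ultrafilter limits, so that each stage of
    an iterated limit is again a test functional. When a sequence already generates a spreading
    model, its iterated limits are exactly the norms of that model, so no further subsequence is
    taken. The blocks are finite sums, whose length also tends to infinity along U. *)

Definition convex_functional (R : realType) (V : lmodType R) (p : V -> R) :=
  forall (s t : R) (x y : V), 0 <= s -> 0 <= t -> s + t = 1 ->
    p (s *: x + t *: y) <= s * p x + t * p y.

Section convex_minorant.
Context {R : realType} {V : lmodType R}.
Implicit Types (p q : V -> R).

Lemma convex_ge_opp q x : convex_functional q -> q 0 = 0 -> - q (- x) <= q x.
Proof.
move=> cq q0; have h : (2%:R^-1 : R) + 2%:R^-1 = 1 by lra.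
have := cq 2%:R^-1 2%:R^-1 x (- x) _ _ h.
rewrite scalerN subrr q0 => /(_ _ _)/wrap[]; [lra|lra|].
by move=> ?; lra.
Qed.

(** The infimum is finite since each member lies above [- p (- x)]. It stays convex because members
    nearly optimal at [x] and at [y] are comparable, and the smaller one serves at both points. *)
Lemma convex_inf_chain (A : set (V -> R)) (p : V -> R) :
  A !=set0 -> total_on A (fun q q' => forall x, q x <= q' x) ->
  (forall q, A q -> [/\ convex_functional q, q 0 = 0 & forall x, q x <= p x]) ->
  let r := fun x => inf [set q x | q in A] in
  [/\ convex_functional r, r 0 = 0 & forall q, A q -> forall x, r x <= q x].
Proof.
move=> [q0 Aq0] Atot AP r.
have hlb x : has_lbound [set q x | q in A].
  exists (- p (- x)) => _ [q Aq <-]; have [cq qz qp] := AP _ Aq.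
  by apply: le_trans (convex_ge_opp _ cq qz); rewrite lerN2.
have rle q : A q -> forall x, r x <= q x.
  by move=> Aq x; apply: ge_inf => //; exists q.
have rge x (c : R) : (forall q, A q -> c <= q x) -> c <= r x.
  by move=> h; apply: lb_le_inf; [exists (q0 x), q0|move=> _ [q Aq <-]; exact: h].
split => //; last first.
  apply/eqP; rewrite eq_le; apply/andP; split.
    by have [_ <- _] := AP _ Aq0; exact: rle.
  by apply: rge => q /AP[_ -> _].
move=> s t x y s0 t0 st1.
have H q q' : A q -> A q' -> r (s *: x + t *: y) <= s * q x + t * q' y.
  move=> Aq Aq'; have [cq _ _] := AP _ Aq; have [cq' _ _] := AP _ Aq'.
  have [qq'|qq'] := Atot _ _ Aq Aq'.
    apply: (le_trans (rle _ Aq _)); apply: (le_trans (cq _ _ _ _ s0 t0 st1)).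
    by rewrite lerD2l ler_wpM2l.
  apply: (le_trans (rle _ Aq' _)); apply: (le_trans (cq' _ _ _ _ s0 t0 st1)).
  by rewrite lerD2r ler_wpM2l.
have hinf z : has_inf [set q z | q in A] by split; [exists (q0 z), q0|exact: hlb].
apply/ler_addgt0Pr => e e0.
have [_ [q Aq <-] qx] := inf_adherent e0 (hinf x).
have [_ [q' Aq' <-] qy] := inf_adherent e0 (hinf y).
apply: (le_trans (H _ _ Aq Aq')).
have -> : e = s * e + t * e by rewrite -mulrDl st1 mul1r.
by rewrite addrACA -!mulrDr lerD// ler_wpM2l// ltW.
Qed.

(* A minimal convex functional vanishing at 0 is linear: it is positively
   homogeneous because s^-1 q(s x) lies below it for s <= 1, and superadditive
   because inf_(t >= 0) (q(x + t y) - t q(y)) lies below it. *)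
Lemma convex_minorant (p : V -> R) : convex_functional p -> p 0 = 0 ->
  exists f : V -> R, (forall (c : R) u v, f (c *: u + v) = c * f u + f v) /\
    (forall x, f x <= p x).
Proof.
move=> cp p0.
pose K := {q : V -> R | [/\ convex_functional q, q 0 = 0 & forall x, q x <= p x]}.
(* The pointwise order is reversed, so that a maximal element from Zorn's lemma is a minimal
   functional. *)
pose le (q q' : K) := `[< forall x, sval q' x <= sval q x >].
have pP : [/\ convex_functional p, p 0 = 0 & forall x, p x <= p x] by split.
have [|||[q [cq q0 qp]] qmin] := @ZL_preorder K (exist _ p pP) le.
- by move=> t; apply/asboolP.
- move=> r s t /asboolP rs /asboolP st; apply/asboolP => x.
  exact: le_trans (st x) (rs x).
- move=> A Atot; have [[a Aa]|A0] := pselect (A !=set0); last first.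
    by exists (exist _ p pP) => s As; exfalso; apply: A0; exists s.
  have [| | |cr r0 rle] := @convex_inf_chain [set sval q | q in A] p.
  + by exists (sval a), a.
  + move=> _ _ [q Aq <-] [q' Aq' <-].
    by have [/asboolP|/asboolP] := Atot _ _ Aq Aq'; [right|left].
  + by move=> _ [[q qP] Aq <-].
  have rp x : inf [set q x | q in [set sval q | q in A]] <= p x.
    have [_ _ ap] := svalP a; apply: le_trans (ap x).
    by apply: rle; exists a.
  pose r x := inf [set q x | q in [set sval q | q in A]].
  have rP : [/\ convex_functional r, r 0 = 0 & forall x, r x <= p x] by split.
  exists (exist _ r rP) => s As; apply/asboolP => x /=.
  by apply: rle; exists s.
have {}qmin r : convex_functional r -> r 0 = 0 -> (forall x, r x <= q x) ->
    forall x, q x <= r x.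
  move=> cr r0 rq; have rp x : r x <= p x by exact: le_trans (rq x) (qp x).
  have rP : [/\ convex_functional r, r 0 = 0 & forall x, r x <= p x] by split.
  by have /(_ (asboolT rq))/asboolP := qmin (exist _ r rP).
have qZle s x : 0 < s -> s <= 1 -> q (s *: x) = s * q x.
  move=> s0 s1; apply/eqP; rewrite eq_le; apply/andP; split.
    have h : s + (1 - s) = 1 by lra.
    have := cq s (1 - s) x 0 (ltW s0) _ h.
    by rewrite scaler0 addr0 q0 mulr0 addr0; apply; lra.
  rewrite mulrC -ler_pdivlMr// mulrC.
  move: x; apply: (qmin (fun x => s^-1 * q (s *: x))).
  - move=> a b x y a0 b0 ab1; rewrite scalerDr !scalerA !(mulrC s) -!scalerA.
    rewrite [leRHS](_ : _ = s^-1 * (a * q (s *: x) + b * q (s *: y))); last first.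
      by rewrite mulrDr !mulrA !(mulrC s^-1).
    by apply: ler_wpM2l; [rewrite invr_ge0 ltW|exact: cq].
  - by rewrite scaler0 q0 mulr0.
  - move=> x; rewrite ler_pdivrMl//.
    have h : s + (1 - s) = 1 by lra.
    have := cq s (1 - s) x 0 (ltW s0) _ h.
    by rewrite scaler0 addr0 q0 mulr0 addr0; apply; lra.
have qZ s x : 0 <= s -> q (s *: x) = s * q x.
  rewrite le_eqVlt => /orP[/eqP <-|s0]; first by rewrite scale0r q0 mul0r.
  have [s1|s1] := leP s 1; first exact: qZle.
  have si : s^-1 <= 1 by rewrite invf_le1 ?ltW.
  have si0 : 0 < s^-1 by rewrite invr_gt0; exact: lt_trans s1.
  have := qZle s^-1 (s *: x) si0 si.
  by rewrite scalerA mulVf ?gt_eqF// scale1r => ->; rewrite mulrA mulfV ?gt_eqF// mul1r.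
have qD x y : q (x + y) <= q x + q y.
  have h2 : (2%:R^-1 : R) + 2%:R^-1 = 1 by lra.
  have h0 : (0 : R) <= 2%:R^-1 by lra.
  have h3 : (0 : R) <= 2 by lra.
  have := cq 2%:R^-1 2%:R^-1 (2 *: x) (2 *: y) h0 h0 h2.
  by rewrite !scalerA mulVf ?pnatr_eq0// !scale1r !qZ// !mulrA mulVf ?pnatr_eq0// !mul1r.
have qS x y : q x + q y <= q (x + y).
  pose S x := [set q (x + t *: y) - t * q y | t in [set t : R | 0 <= t]].
  have Slb z : lbound (S z) (- q (- z)).
    move=> _ [t t0 <-]; have := qD (z + t *: y) (- z).
    rewrite addrC addKr qZ// => h; lra.
  have S0 z : S z !=set0 by exists (q (z + 0 *: y) - 0 * q y), 0 => //=.
  have Sle z t : 0 <= t -> inf (S z) <= q (z + t *: y) - t * q y.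
    by move=> t0; apply: ge_inf; [exists (- q (- z))|exists t].
  suff : forall z, q z <= inf (S z).
    move=> /(_ x) h; have := Sle x 1 ler01; rewrite scale1r mul1r; lra.
  apply: (qmin (fun z => inf (S z))).
  - move=> a b u v a0 b0 ab1.
    have H s t : 0 <= s -> 0 <= t -> inf (S (a *: u + b *: v)) <=
        a * (q (u + s *: y) - s * q y) + b * (q (v + t *: y) - t * q y).
      move=> s0 t0; apply: le_trans (Sle _ (a * s + b * t) _) _.
        by rewrite addr_ge0// mulr_ge0.
      have := cq a b (u + s *: y) (v + t *: y) a0 b0 ab1.
      rewrite !scalerDr !scalerA addrACA -scalerDl => h.
      by rewrite !mulrBr mulrDl !mulrA; lra.
    apply/ler_addgt0Pr => e e0.
    have [_ [s s0 <-] us] := inf_adherent e0 (conj (S0 u) (ex_intro _ _ (Slb u))).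
    have [_ [t t0 <-] vt] := inf_adherent e0 (conj (S0 v) (ex_intro _ _ (Slb v))).
    apply: (le_trans (H s t s0 t0)).
    have -> : e = a * e + b * e by rewrite -mulrDl ab1 mul1r.
    by rewrite addrACA -!mulrDr lerD// ler_wpM2l// ltW.
  - apply/eqP; rewrite eq_le; apply/andP; split.
      by have := Sle 0 0 (lexx _); rewrite scale0r addr0 q0 mul0r subr0.
    apply: lb_le_inf => // _ [t t0 <-].
    by rewrite add0r qZ// subrr.
  - by move=> z; have := Sle z 0 (lexx _); rewrite scale0r addr0 mul0r subr0.
have qA x y : q (x + y) = q x + q y by apply/eqP; rewrite eq_le qD qS.
have qN x : q (- x) = - q x.
  by apply/eqP; rewrite -addr_eq0 -qA addrC subrr q0.
exists q; split => // c u v; rewrite qA; congr (_ + _).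
have [c0|c0] := leP 0 c; first exact: qZ.
by rewrite -[c]opprK scaleNr qN qZ ?mulNr// oppr_ge0 ltW.
Qed.

End convex_minorant.

(** * Bounded functions as a complete normed module *)

Section linf.
Context (R : realType) (T : Type).

Definition linf_pred : {pred T -> R} :=
  fun f => `[< exists M, forall x, `|f x| <= M >].

Lemma linf_submod_closed : submod_closed linf_pred.
Proof.
split => [|c f g /asboolP[M Mf] /asboolP[N Ng]].
  by apply/asboolP; exists 0 => x; rewrite normr0.
apply/asboolP; exists (`|c| * M + N) => x.
rewrite (le_trans (ler_normD _ _))// lerD// normrM.
by rewrite ler_wpM2l.
Qed.

HB.instance Definition _ := GRing.isSubmodClosed.Build R (T -> R) linf_pred
  linf_submod_closed.

(** The models must live in complete spaces. Mapping seminormed spaces into this one replaces the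
    quotient and completion of c_00. *)
Record linf := Linf { linf_fun :> T -> R; _ : linf_fun \in linf_pred }.

HB.instance Definition _ := [isSub for linf_fun].
HB.instance Definition _ := [Choice of linf by <:].
HB.instance Definition _ := [SubChoice_isSubLmodule of linf by <:].

Implicit Types f g : linf.

Definition linf_norm f : R := sup [set `|f x| | x in [set: T]].

Let has_ub f : has_ubound [set `|f x| | x in [set: T]].
Proof.
by case: f => f /= /asboolP[M Mf]; exists M => _ [x _ <-].
Qed.

Lemma linf_le_norm f x : `|f x| <= linf_norm f.
Proof. by apply: ub_le_sup => //; exists x. Qed.

Lemma linf_norm_le f (M : R) : 0 <= M -> (forall x, `|f x| <= M) -> linf_norm f <= M.
Proof.
(* For empty [T] the supremum is that of the empty set, whose value is 0. *)
move=> M0 h; have [[x _]|/nonemptyPn T0] := pselect ([set: T] !=set0).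
  by apply: ge_sup; [exists (`|f x|), x|move=> _ [y _ <-]].
by rewrite /linf_norm T0 image_set0 sup0.
Qed.

Lemma linf_norm_ge0 f : 0 <= linf_norm f.
Proof.
have [[x _]|/nonemptyPn T0] := pselect ([set: T] !=set0).
  exact: le_trans (linf_le_norm f x).
by rewrite /linf_norm T0 image_set0 sup0.
Qed.

Let ler_normD f g : linf_norm (f + g) <= linf_norm f + linf_norm g.
Proof.
apply: linf_norm_le => [|x]; first by rewrite addr_ge0 ?linf_norm_ge0.
by rewrite (le_trans (Num.Theory.ler_normD _ _))// lerD// linf_le_norm.
Qed.

Let normrZ (c : R) f : linf_norm (c *: f) = `|c| * linf_norm f.
Proof.
apply/eqP; rewrite eq_le; apply/andP; split.
  apply: linf_norm_le => [|x]; first by rewrite mulr_ge0 ?linf_norm_ge0.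
  by rewrite normrM ler_wpM2l// linf_le_norm.
have [->|c0] := eqVneq c 0; first by rewrite normr0 mul0r linf_norm_ge0.
rewrite -ler_pdivlMl ?normr_gt0//.
apply: linf_norm_le => [|x].
  by rewrite mulr_ge0 ?invr_ge0// linf_norm_ge0.
by rewrite ler_pdivlMl ?normr_gt0// -normrM; exact: (linf_le_norm (c *: f)).
Qed.

Let normr0_eq0 f : linf_norm f = 0 -> f = 0.
Proof.
move=> f0; apply/val_inj/funext => x /=.
by apply/eqP; rewrite -normr_le0 -f0 linf_le_norm.
Qed.

HB.instance Definition _ := Lmodule_isNormed.Build R linf ler_normD normrZ normr0_eq0.

Let linf_complete (F : set_system linf) : ProperFilter F -> cauchy F -> cvg F.
Proof.
move=> FF /cauchy_ballP Fc.
have close (e : R) : 0 < e ->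
    exists2 A, F A & forall f g x, A f -> A g -> `|f x - g x| <= e.
  move=> e0; have [[A B] /= [FA FB] AB] := Fc _ e0.
  exists (A `&` B); first exact: filterI.
  move=> f g x [Af _] [_ Bg]; have /= := AB (f, g) (conj Af Bg).
  rewrite -ball_normE /ball_ /= => /ltW; apply: le_trans.
  exact: (linf_le_norm (f - g)).
pose h x := lim ((fun f : linf => f x) @ F).
have hcv x : (fun f : linf => f x) @ F --> h x.
  apply: cauchy_cvg; apply/cauchy_ballP => e e0.
  have e20 : 0 < e / 2 by rewrite divr_gt0.
  have [A FA AB] := close _ e20.
  have FA' : ((fun f : linf => f x) @ F) [set f x | f in A].
    by apply: (@filterS _ F _ A) => // f Af; exists f.
  exists ([set f x | f in A], [set f x | f in A]) => //.
  move=> [_ _] /= [[f Af <-] [g Ag <-]]; rewrite -ball_normE /ball_ /=.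
  by apply: le_lt_trans (AB f g x Af Ag) _; lra.
have hle (e : R) : 0 < e -> F [set f : linf | forall x, `|h x - f x| <= e].
  move=> e0; have [A FA AB] := close _ e0.
  apply: (filterS _ (FA)) => f Af x.
  have cv : (fun g : linf => g x - f x) @ F --> h x - f x.
    exact: (@cvgB R R _ F _ (fun g : linf => g x) (fun=> f x) _ _ (hcv x) (cvg_cst _)).
  apply: (cvgr_to_le (cvg_norm cv)).
  by apply: filterS FA => g Ag; exact: AB.
have hb : h \in linf_pred.
  have [f fh] := filter_ex (hle 1 ltr01).
  apply/asboolP; exists (1 + linf_norm f) => x.
  rewrite -[h x](subrK (f x)) (le_trans (Num.Theory.ler_normD _ _))//.
  by rewrite lerD// linf_le_norm.
apply/cvg_ex; exists (Linf hb); apply/cvgrPdist_le => e e0.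
apply: filterS (hle _ e0) => f fh.
by apply: linf_norm_le; [exact: ltW|exact: fh].
Qed.

HB.instance Definition _ := Uniform_isComplete.Build linf linf_complete.

End linf.

(* Hahn-Banach embeds (V, G) into the bounded functions on the set of linear
   functionals dominated by G. *)
Lemma seminorm_embedding (R : realType) (V : lmodType R) (G : V -> R) :
  (forall x y, G (x + y) <= G x + G y) ->
  (forall (c : R) x, G (c *: x) = `|c| * G x) ->
  exists (Z : completeNormedModType R) (T : V -> Z),
    (forall (c : R) x y, T (c *: x + y) = c *: T x + T y) /\
    (forall x, `|T x| = G x).
Proof.
move=> GD GZ.
have G0 : G 0 = 0 by rewrite -(scale0r 0) GZ normr0 mul0r.
have GN x : G (- x) = G x by rewrite -scaleN1r GZ normrN1 mul1r.
have Gge0 x : 0 <= G x by have := GD x (- x); rewrite subrr G0 GN => ?; lra.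
pose D := {f : V -> R | (forall (c : R) x y, f (c *: x + y) = c * f x + f y) /\
                        (forall x, f x <= G x)}.
have Dle (f : D) x : `|sval f x| <= G x.
  case: f => f /= [flin fG]; rewrite ler_norml fG andbT lerNl.
  have f0 : f 0 = 0 by have := flin 1 0 0; rewrite scaler0 addr0 mul1r => ?; lra.
  by have := flin (-1) x 0; rewrite f0 !addr0 scaleN1r mulN1r => <-; rewrite -[G x]GN.
have TP x : (fun f : D => sval f x) \in @linf_pred R D.
  by apply/asboolP; exists (G x) => f; exact: Dle.
exists (linf R D : completeNormedModType R), (fun x => Linf (TP x)); split.
  by move=> c x y; apply/val_inj/funext => -[f [flin fG]] /=; rewrite flin.
move=> x; apply/eqP; rewrite eq_le; apply/andP; split.
  by apply: linf_norm_le => // f; exact: Dle.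
(* A linear minorant of the increment of [G] at [x] is dominated by [G], and its value at [- x]
   forces [G x <= f x]: it is a norming functional at [x]. *)
have [||f [flin fle]] := @convex_minorant R V (fun v => G (x + v) - G x).
- move=> s t u v s0 t0 st1.
  have -> : x + (s *: u + t *: v) = s *: (x + u) + t *: (x + v).
    by rewrite !scalerDr addrACA -scalerDl st1 scale1r.
  have := GD (s *: (x + u)) (t *: (x + v)); rewrite !GZ !ger0_norm//.
  rewrite !mulrBr addrACA -opprD -mulrDl st1 mul1r => ?; lra.
- by rewrite addr0 subrr.
have fG v : f v <= G v by have := fle v; have := GD x v; move=> ? ?; lra.
have fx : G x <= f x.
  have := fle (- x); rewrite subrr G0 => h.
  have f0 : f 0 = 0 by have := flin 1 0 0; rewrite scaler0 addr0 mul1r => ?; lra.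
  by have := flin (-1) x 0; rewrite f0 !addr0 scaleN1r mulN1r => hN; lra.
apply: le_trans fx _; apply: le_trans (ler_norm _) _.
exact: (linf_le_norm (Linf (TP x)) (exist _ f (conj flin fG))).
Qed.

(** * Iterated ultrafilter limits of norms *)

Lemma ultra_filterP T (F : set_system T) : ProperFilter F ->
  (forall A, F A \/ F (~` A)) -> UltraFilter F.
Proof.
move=> PF FP; split => // G PG FG; apply/seteqP; split => // A GA.
have [//|/FG GCA] := FP A.
have /filter_not_empty[] : G set0 by rewrite -(setICr A); exact: filterI.
Qed.

Lemma ultra_fmap T U (f : T -> U) (F : set_system T) :
  UltraFilter F -> UltraFilter (f @ F).
Proof.
by move=> UF; apply: ultra_filterP => A; exact: (in_ultra_setVsetC (f @^-1` A) UF).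
Qed.

Lemma ultra_bounded_cvg (R : realType) T (F : set_system T) (g : T -> R) (M : R) :
  UltraFilter F -> (forall t, `|g t| <= M) -> cvg (g @ F).
Proof.
move=> UF gM; have UgF := ultra_fmap g UF.
have := @segment_compact R (- M) M.
rewrite compact_ultra => /(_ _ UgF)[].
  by apply: (@filterE _ F) => t /=; rewrite in_itv/= -ler_norml.
by move=> l [_ gl]; apply/cvg_ex; exists l.
Qed.

Lemma le_cvg_to (R : realType) T (F : set_system T) (f g : T -> R) (l l' : R) :
  ProperFilter F -> f @ F --> l -> g @ F --> l' -> (forall t, f t <= g t) -> l <= l'.
Proof.
move=> PF fl gl fg; rewrite -subr_ge0.
apply: (cvgr_to_ge (cvgB gl fl)).
by apply: filterE => t /=; rewrite subr_ge0.
Qed.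

Definition weakly_null_along (R : realType) (X : normedModType R) J
    (V : set_system J) (v : J -> X) :=
  forall f : X -> R, is_linear_functional f -> continuous f ->
    (fun j => f (v j)) @ V --> (0 : R).

(** The test functionals. Convexity yields subgradients; the Lipschitz bound makes these continuous
    and makes limits along ultrafilters exist on bounded families. Every iterated seminorm belongs
    to the class ([iter_norm_convex_lipschitz]). *)
Definition convex_lipschitz (R : realType) (X : normedModType R) (G : X -> R) :=
  convex_functional G /\
  exists2 L : R, 0 <= L & forall x y, `|G x - G y| <= L * `|x - y|.

Section convex_lipschitz.
Context {R : realType} {X : normedModType R}.
Implicit Types (G : X -> R).

Lemma convex_lipschitz_shift G u : convex_lipschitz G ->
  convex_lipschitz (fun x => G (u + x)).
Proof.
move=> [cG [L L0 LG]]; split.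
  move=> s t x y s0 t0 st1.
  have -> : u + (s *: x + t *: y) = s *: (u + x) + t *: (u + y).
    by rewrite !scalerDr addrACA -scalerDl st1 scale1r.
  exact: cG.
exists L => // x y; apply: le_trans (LG _ _) _.
by rewrite [u + x]addrC addrKA.
Qed.

Lemma lipschitz_bounded G (L : R) J (v : J -> X) (B : R) :
  0 <= L -> (forall x y, `|G x - G y| <= L * `|x - y|) ->
  (forall j, `|v j| <= B) -> forall j, `|G (v j)| <= `|G 0| + L * B.
Proof.
move=> L0 LG vB j; rewrite -[G (v j)](subrK (G 0)) addrC.
rewrite (le_trans (ler_normD _ _))// lerD2l (le_trans (LG _ _))//.
by rewrite subr0 ler_wpM2l.
Qed.

Lemma convex_lipschitz_cvg G J (V : set_system J) (v : J -> X) (B : R) :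
  UltraFilter V -> convex_lipschitz G -> (forall j, `|v j| <= B) ->
  cvg ((fun j => G (v j)) @ V).
Proof.
move=> UV [_ [L L0 LG]] vB.
exact: (ultra_bounded_cvg UV (lipschitz_bounded L0 LG vB)).
Qed.

Lemma bounded_functional_continuous (f : X -> R) (L : R) :
  is_linear_functional f -> (forall x, `|f x| <= L * `|x|) -> continuous f.
Proof.
move=> flin fL y; apply/cvgrPdist_le => e e0.
have L1 : 0 < `|L| + 1 by rewrite ltr_wpDl.
have d0 : 0 < e / (`|L| + 1) by rewrite divr_gt0.
have : \forall x \near y, `|y - x| <= e / (`|L| + 1).
  exact: (@cvgr_dist_le _ _ _ (nbhs y) _ id y (@cvg_id _ _) _ d0).
apply: filterS => x xy.
have -> : f y - f x = f (y - x).
  by have := flin (-1) x y; rewrite scaleN1r mulN1r => h; rewrite [f y - _]addrC -h addrC.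
apply: le_trans (fL _) _.
apply: (@le_trans _ _ ((`|L| + 1) * `|y - x|)).
  by rewrite ler_wpM2r// (le_trans (ler_norm _))// lerDl.
by rewrite mulrC -ler_pdivlMr.
Qed.

Lemma linear_functional0 (f : X -> R) : is_linear_functional f -> f 0 = 0.
Proof. by move=> flin; have := flin 1 0 0; rewrite scaler0 addr0 mul1r => ?; lra. Qed.

Lemma linear_functionalZ (f : X -> R) (c : R) x :
  is_linear_functional f -> f (c *: x) = c * f x.
Proof.
by move=> flin; have := flin c x 0; rewrite linear_functional0// !addr0.
Qed.

Lemma linear_functionalN (f : X -> R) x : is_linear_functional f -> f (- x) = - f x.
Proof. by move=> flin; rewrite -scaleN1r linear_functionalZ// mulN1r. Qed.

(** A linear minorant of the increment of [G] at [u] is bounded by [L] times the norm, hence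
    continuous, so weak nullity applies to it. *)
Lemma convex_subgradient G u : convex_lipschitz G ->
  exists f : X -> R, [/\ is_linear_functional f, continuous f &
    forall x, G u + f x <= G (u + x)].
Proof.
move=> Gcl; have [cG [L L0 LG]] := Gcl.
have [||f [flin fle]] := @convex_minorant R X (fun x => G (u + x) - G u).
- have [cS _] := convex_lipschitz_shift u Gcl.
  move=> s t x y s0 t0 st1; have := cS s t x y s0 t0 st1.
  by rewrite !mulrBr addrACA -opprD -mulrDl st1 mul1r lerD2r.
- by rewrite addr0 subrr.
have fL x : f x <= L * `|x|.
  apply: (le_trans (fle x)); apply: (le_trans (ler_norm _)).
  by apply: (le_trans (LG _ _)); rewrite [u + x]addrC addrK.
exists f; split => //; last by move=> x; rewrite -lerBrDl.
apply: (@bounded_functional_continuous _ L) => // x.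
by rewrite ler_norml fL andbT lerNl -linear_functionalN// -[`|x|]normrN.
Qed.

Lemma weakly_null_le_lim G J (V : set_system J) (v : J -> X) (B : R) u :
  UltraFilter V -> convex_lipschitz G -> (forall j, `|v j| <= B) ->
  weakly_null_along V v -> G u <= lim ((fun j => G (u + v j)) @ V).
Proof.
move=> UV Gcl vB vnull; have [f [flin fcont fle]] := convex_subgradient u Gcl.
have c1 : (fun j => G u + f (v j)) @ V --> G u + 0.
  by apply: cvgD; [exact: cvg_cst|exact: vnull].
have c2 := convex_lipschitz_cvg UV (convex_lipschitz_shift u Gcl) vB.
rewrite -[G u]addr0; apply: (le_cvg_to _ c1 c2).
by move=> j; exact: fle.
Qed.

End convex_lipschitz.

Section iterated_norm.
Context {R : realType} {X : normedModType R} {J : Type}.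
Variables (V : set_system J).
Context {UV : UltraFilter V}.
Implicit Types (z : nat -> J -> X) (u : X) (b : nat -> R).

(** [u] accumulates the vectors already chosen. The limit over the term of index 0 is the outermost
    one: each term is fixed before the later ones are sent to infinity. *)
Fixpoint iter_norm n z u : R :=
  if n is m.+1 then lim ((fun j => iter_norm m (fun i => z i.+1) (u + z 0%N j)) @ V)
  else `|u|.

Lemma iter_norm_bounds n z b u : (forall i j, `|z i j| <= b i) ->
  0 <= iter_norm n z u <= `|u| + \sum_(i < n) b i.
Proof.
elim: n z b u => [|n IH] z b u zb /=; first by rewrite big_ord0 addr0 lexx normr_ge0.
have H j : 0 <= iter_norm n (fun i => z i.+1) (u + z 0%N j)
             <= `|u| + \sum_(i < n.+1) b i.
  have /andP[-> h] := IH (fun i => z i.+1) (fun i => b i.+1) (u + z 0%N j)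
                         (fun i => zb i.+1).
  rewrite (le_trans h)// big_ord_recl addrA lerD2r.
  by rewrite (le_trans (ler_normD _ _))// lerD2l.
have cv : cvg ((fun j => iter_norm n (fun i => z i.+1) (u + z 0%N j)) @ V).
  apply: (@ultra_bounded_cvg _ _ _ _ (`|u| + \sum_(i < n.+1) b i)) => j.
  by have /andP[h ?] := H j; rewrite ger0_norm.
apply/andP; split.
  by apply: limr_ge => //; apply: filterE => j; have /andP[] := H j.
by apply: limr_le => //; apply: filterE => j; have /andP[] := H j.
Qed.

Lemma iter_norm_cvg n z b u : (forall i j, `|z i j| <= b i) ->
  (fun j => iter_norm n (fun i => z i.+1) (u + z 0%N j)) @ V --> iter_norm n.+1 z u.
Proof.
move=> zb.
apply: (@ultra_bounded_cvg _ _ _ _ (`|u| + \sum_(i < n.+1) b i)) => j.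
have /andP[h1 h2] := iter_norm_bounds n (u + z 0%N j) (fun i => zb i.+1).
rewrite ger0_norm// (le_trans h2)// big_ord_recl addrA lerD2r.
by rewrite (le_trans (ler_normD _ _))// lerD2l.
Qed.

Arguments iter_norm_cvg n {z b} u zb.

Lemma iter_normD n z z' b b' u u' :
  (forall i j, `|z i j| <= b i) -> (forall i j, `|z' i j| <= b' i) ->
  iter_norm n (fun i j => z i j + z' i j) (u + u')
    <= iter_norm n z u + iter_norm n z' u'.
Proof.
elim: n z z' b b' u u' => [|n IH] z z' b b' u u' zb zb'; first exact: ler_normD.
have zzb i j : `|z i j + z' i j| <= b i + b' i.
  by rewrite (le_trans (ler_normD _ _))// lerD.
have cD := cvgD (iter_norm_cvg n u zb) (iter_norm_cvg n u' zb').
have cS := iter_norm_cvg n (z := fun i j => z i j + z' i j) (u + u') zzb.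
apply: (le_cvg_to _ cS (cD _)).
move=> j /=; rewrite addrACA.
exact: (IH _ _ _ _ _ _ (fun i => zb i.+1) (fun i => zb' i.+1)).
Qed.

Lemma iter_normZ n z b u (c : R) : (forall i j, `|z i j| <= b i) ->
  iter_norm n (fun i j => c *: z i j) (c *: u) = `|c| * iter_norm n z u.
Proof.
elim: n z b u => [|n IH] z b u zb; first exact: normrZ.
have cv := cvgM (cvg_cst (`|c|)) (iter_norm_cvg n u zb).
rewrite -(cvg_lim _ (cv _ _))//=; congr (lim (_ @ V)); apply/funext => j /=.
by rewrite -scalerDr (IH _ _ _ (fun i => zb i.+1)).
Qed.

Lemma eq_iter_norm n z z' u : (forall i j, (i < n)%N -> z i j = z' i j) ->
  iter_norm n z u = iter_norm n z' u.
Proof.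
elim: n z z' u => [//|n IH] z z' u zz /=; congr (lim (_ @ V)); apply/funext => j.
by rewrite zz//; apply: IH => i k ik; exact: zz.
Qed.

Lemma iter_norm_lipschitz n z z' b b' d u u' :
  (forall i j, `|z i j| <= b i) -> (forall i j, `|z' i j| <= b' i) ->
  (forall i j, `|z i j - z' i j| <= d i) ->
  `|iter_norm n z u - iter_norm n z' u'| <= `|u - u'| + \sum_(i < n) d i.
Proof.
suff H y y' c c' w w' : (forall i j, `|y i j| <= c i) ->
    (forall i j, `|y' i j| <= c' i) -> (forall i j, `|y i j - y' i j| <= d i) ->
    iter_norm n y w - iter_norm n y' w' <= `|w - w'| + \sum_(i < n) d i.
  move=> zb zb' zd; rewrite ler_norml (H _ _ _ _ _ _ zb zb')// andbT lerNl opprB.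
  rewrite distrC (H _ _ _ _ _ _ zb' zb)// => i j; rewrite distrC; exact: zd.
move=> yc yc' yd; rewrite lerBlDl.
have := iter_normD n w' (w - w') yc' yd.
rewrite subrKC (_ : (fun _ => _) = y); last first.
  by apply/funext => i; apply/funext => j; rewrite subrKC.
move=> /le_trans; apply; rewrite lerD2l.
by have /andP[] := iter_norm_bounds n (w - w') yd.
Qed.

Lemma iter_norm_convex_lipschitz n z b : (forall i j, `|z i j| <= b i) ->
  convex_lipschitz (iter_norm n z).
Proof.
move=> zb; split => [s t x y s0 t0 st1|].
  have sb i j (c : R) : `|c *: z i j| <= `|c| * b i by rewrite normrZ ler_wpM2l.
  have := iter_normD n (s *: x) (t *: y) (fun i j => sb i j s) (fun i j => sb i j t).
  rewrite !(iter_normZ _ _ _ zb) !ger0_norm// (_ : (fun _ => _) = z)//.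
  by apply/funext => i; apply/funext => j; rewrite -scalerDl st1 scale1r.
exists 1 => // x y; rewrite mul1r.
have z0 i j : `|z i j - z i j| <= (fun=> 0 : R) i by rewrite subrr normr0.
by have := iter_norm_lipschitz n x y zb zb z0; rewrite big1 ?addr0.
Qed.

(** Dropping final weakly null terms costs no constant; hence the unit vectors of a model form a
    basic sequence with constant 1. *)
Lemma iter_norm_mono m n z b u : (m <= n)%N -> (forall i j, `|z i j| <= b i) ->
  (forall i, weakly_null_along V (z i)) -> iter_norm m z u <= iter_norm n z u.
Proof.
elim: n m z b u => [|n IH] [|m] z b u //= mn zb znull.
  apply: (le_trans (IH 0%N (fun i => z i.+1) (fun i => b i.+1) u _ _ _)) => //.
  exact: (weakly_null_le_lim u UV
    (iter_norm_convex_lipschitz n (fun i => zb i.+1)) (zb 0%N)).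
apply: (le_cvg_to _ (iter_norm_cvg m u zb) (iter_norm_cvg n u zb)).
move=> j; exact: (IH _ _ _ _ _ (fun i => zb i.+1)).
Qed.

Lemma iter_norm_pad m k z u : (forall i j, (m <= i)%N -> z i j = 0) ->
  iter_norm (m + k) z u = iter_norm m z u.
Proof.
elim: m k z u => [|m IH] k z u z0; last first.
  rewrite addSn /=; congr (lim (_ @ V)); apply/funext => j.
  by apply: IH => i l mi; exact: z0.
rewrite add0n; elim: k z u z0 => [//|k IHk] z u z0 /=.
have -> : (fun j => iter_norm k (fun i => z i.+1) (u + z 0%N j)) = (fun=> `|u|).
  by apply/funext => j; rewrite IHk ?z0 ?addr0// => i l _; rewrite z0.
exact: lim_cst.
Qed.

(** The terms before [i] are dropped by weak nullity at 0 and those after [i] by monotonicity, which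
    leaves the norm of a single term. *)
Lemma iter_norm_coef n z b i (c : R) : (i < n)%N -> (forall i j, `|z i j| <= b i) ->
  (forall i, weakly_null_along V (z i)) -> (\forall j \near V, `|z i j| = c) ->
  c <= iter_norm n z 0.
Proof.
elim: n i z b => [//|n IH] [|i] z b //= lt_in zb znull zc.
  apply: limr_ge; first exact: (iter_norm_cvg n 0 zb).
  apply: filterS zc => j <-; rewrite add0r.
  exact: (@iter_norm_mono 0 n _ _ _ _ (fun i => zb i.+1)).
apply: (le_trans (IH i _ _ lt_in (fun i => zb i.+1) _ zc)) => //.
exact: (weakly_null_le_lim 0 UV
  (iter_norm_convex_lipschitz n (fun i => zb i.+1)) (zb 0%N)).
Qed.

End iterated_norm.
Arguments iter_norm_cvg {R X J V UV} n {z b} u zb.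

(** Families are exchanged one at a time: once the inner limits have been compared by induction, the
    remaining expression is a convex Lipschitz function of the outermost term, to which the
    hypothesis applies. *)
Lemma iter_norm_le_comparison (R : realType) (X : normedModType R) J J'
    (V : set_system J) (V' : set_system J') n (z : nat -> J -> X)
    (z' : nat -> J' -> X) (b b' : nat -> R) u :
  UltraFilter V -> UltraFilter V' ->
  (forall i j, `|z i j| <= b i) -> (forall i j, `|z' i j| <= b' i) ->
  (forall i (G : X -> R), convex_lipschitz G ->
    lim ((fun j => G (z i j)) @ V) <= lim ((fun j => G (z' i j)) @ V')) ->
  iter_norm V n z u <= iter_norm V' n z' u.
Proof.
move=> UV UV'; elim: n z z' b b' u => [//|n IH] z z' b b' u zb zb' H.
pose G x := iter_norm V' n (fun i => z' i.+1) (u + x).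
have Gcl : convex_lipschitz G.
  exact/convex_lipschitz_shift/(iter_norm_convex_lipschitz n (fun i => zb' i.+1)).
apply: le_trans (H 0%N G Gcl).
apply: (le_cvg_to _ (iter_norm_cvg n u zb) (convex_lipschitz_cvg UV Gcl (zb 0%N))).
move=> j.
exact: (IH _ _ _ _ _ (fun i => zb i.+1) (fun i => zb' i.+1) (fun i => H i.+1)).
Qed.

(** * Basic sequences *)

Lemma cvg_sum_ord (R : realType) (X : normedModType R) T (F : set_system T) n
    (f : nat -> T -> X) (l : nat -> X) :
  Filter F -> (forall i, (i < n)%N -> f i @ F --> l i) ->
  (fun t => \sum_(i < n) f i t) @ F --> \sum_(i < n) l i.
Proof.
move=> FF fl; apply: (@cvg_big X _ _ _ _ (@add_continuous X)) => i _.
exact: fl.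
Qed.

Lemma nat_ultra : exists U : set_system nat,
  UltraFilter U /\ forall N, U [set k | (N <= k)%N].
Proof.
have [U [UU oU]] := @ultraFilterLemma nat \oo _.
by exists U; split => // N; apply: oU; exact: nbhs_infty_ge.
Qed.

Section grunblum.
Context {R : realType} {X : normedModType R}.
Variables (x : nat -> X) (K : R).
Hypothesis x_neq0 : forall n, x n != 0.
Hypothesis K_ge0 : 0 <= K.
Hypothesis xK : forall (a : nat -> R) m n, (m <= n)%N ->
  `|\sum_(i < m) a i *: x i| <= K * `|\sum_(i < n) a i *: x i|.

Let coef_le (a : nat -> R) i n : (i < n)%N ->
  `|a i| <= 2 * K * `|\sum_(k < n) a k *: x k| / `|x i|.
Proof.
move=> lt_in; rewrite ler_pdivlMr ?normr_gt0// -normrZ.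
have -> : a i *: x i = \sum_(k < i.+1) a k *: x k - \sum_(k < i) a k *: x k.
  by rewrite big_ord_recr /= addrAC subrr add0r.
rewrite (le_trans (ler_normB _ _))// -mulrA mulr_natl mulr2n.
by rewrite lerD// xK// ltnW.
Qed.

Let sum_pad (a : nat -> R) n m : (n <= m)%N -> (forall i, (n <= i)%N -> a i = 0) ->
  \sum_(i < m) a i *: x i = \sum_(i < n) a i *: x i.
Proof.
move=> nm a0; rewrite -(subnKC nm) big_split_ord /= [X in _ + X]big1 ?addr0// => i _.
by rewrite a0 ?leq_addr// scale0r.
Qed.

(** The Grunblum criterion. Approximants of [y] by finite combinations have bounded coefficients,
    and the limits of these along an ultrafilter are the coefficients of [y]: the bound on partial
    sums, uniform in their length, passes to the limit. *)
Lemma grunblum_basic_seq : basic_seq x.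
Proof.
move=> y cy.
have /choice[w wP] : forall k : nat, exists w : nat * (nat -> R),
    (forall i, (w.1 <= i)%N -> w.2 i = 0) /\
    `|y - \sum_(i < w.1) w.2 i *: x i| <= k.+1%:R^-1.
  move=> k; have e0 : 0 < (k.+1%:R^-1 : R) by rewrite invr_gt0 ltr0n.
  have [u [[n [a ->]]]] := cy _ (nbhsx_ballx y _ e0).
  rewrite -ball_normE /ball_ /= => /ltW h.
  exists (n, fun i => if (i < n)%N then a i else 0); split.
    by move=> i /= ni; rewrite ltnNge ni.
  rewrite /=; under eq_bigr => i _ do rewrite ltn_ord.
  exact: h.
pose N k := (w k).1; pose c k := (w k).2.
pose u k := \sum_(i < N k) c k i *: x i.
have c0 k i : (N k <= i)%N -> c k i = 0 by move: i; exact: (wP k).1.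
have uy k : `|y - u k| <= k.+1%:R^-1 by exact: (wP k).2.
have uE k m : (N k <= m)%N -> u k = \sum_(i < m) c k i *: x i.
  by move=> h; rewrite (sum_pad h)// => i; exact: c0.
have udist k l : `|u k - u l| <= k.+1%:R^-1 + l.+1%:R^-1.
  rewrite -(subrKA y) (le_trans (ler_normD _ _))// lerD//.
  by rewrite distrC.
have diffE k l m : (N k <= m)%N -> (N l <= m)%N ->
    u k - u l = \sum_(i < m) (c k i - c l i) *: x i.
  move=> h h'; rewrite (uE _ _ h) (uE _ _ h') -sumrB.
  by apply: eq_bigr => i _; rewrite scalerBl.
have pdist k l m : `|\sum_(i < m) (c k i - c l i) *: x i| <= K * `|u k - u l|.
  pose M := maxn m (maxn (N k) (N l)).
  rewrite (@diffE k l M) ?/M ?leq_max ?leqnn ?orbT//.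
  by apply: (xK (fun i => c k i - c l i)); rewrite leq_max leqnn.
have [U [UU Uge]] := nat_ultra.
have cbnd i k : `|c k i| <= 2 * K * (`|y| + 1) / `|x i|.
  have lt_iM : (i < maxn i.+1 (N k))%N by rewrite leq_max leqnn.
  have := coef_le (c k) lt_iM; rewrite -uE ?leq_max ?leqnn ?orbT// => /le_trans; apply.
  rewrite ler_wpM2r ?invr_ge0// ler_wpM2l ?mulr_ge0//.
  rewrite -[u k](subrKC y) (le_trans (ler_normD _ _))// lerD2l distrC.
  by rewrite (le_trans (uy k))// invf_le1 ?ler1n// ltr0n.
pose a i := lim ((fun k => c k i) @ U).
have ca i : (fun k => c k i) @ U --> a i := ultra_bounded_cvg UU (cbnd i).
have adist k m : `|\sum_(i < m) (a i - c k i) *: x i| <= K * (2 * k.+1%:R^-1).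
  have cv : (fun l => \sum_(i < m) (c l i - c k i) *: x i) @ U -->
            \sum_(i < m) (a i - c k i) *: x i.
    apply: (@cvg_sum_ord _ _ _ _ _ (fun i l => (c l i - c k i) *: x i)
      (fun i => (a i - c k i) *: x i)) => i _.
    apply: cvgZr_tmp; apply: (@cvgB R R); first exact: ca.
    exact: cvg_cst.
  apply: (cvgr_to_le (cvg_norm cv)).
  apply: filterS (Uge k) => l /= kl; apply: (le_trans (pdist _ _ _)).
  rewrite ler_wpM2l// (le_trans (udist _ _))// mulr_natl mulr2n lerD2r.
  by rewrite lef_pV2 ?posrE ?ltr0n// ler_nat ltnS.
have acv : (fun n => \sum_(i < n) a i *: x i) @ \oo --> y.
  apply/cvgrPdist_le => e e0.
  have e1 : 0 < e / (2 * K + 1) by rewrite divr_gt0// ltr_wpDl// mulr_ge0.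
  have [k /= hk] := filter_ex (near_infty_natSinv_lt (PosNum e1)).
  exists (N k) => // m /= Nm.
  have -> : y - \sum_(i < m) a i *: x i = (y - u k) - \sum_(i < m) (a i - c k i) *: x i.
    rewrite (uE _ _ Nm) -addrA -opprD -big_split /=; congr (_ - _).
    by apply: eq_bigr => i _; rewrite -scalerDl subrKC.
  rewrite (le_trans (ler_normB _ _))//.
  apply: (le_trans (lerD (uy k) (adist k m))).
  move: hk; rewrite ltr_pdivlMr ?ltr_wpDl ?mulr_ge0//.
  by move=> /ltW; apply: le_trans; rewrite le_eqVlt; apply/orP; left; apply/eqP; ring.
exists a; split => // b bcv; apply/funext => i.
have dcv : (fun n => \sum_(i < n) (a i - b i) *: x i) @ \oo --> (0 : X).
  have cv := cvgB acv bcv; rewrite subrr in cv.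
  apply: cvg_trans (cv _); apply: near_eq_cvg; apply: filterE => n /=.
  rewrite !fctE -sumrB.
  by apply: eq_bigr => k _; rewrite scalerBl.
have d0 m : \sum_(i < m) (a i - b i) *: x i = 0.
  apply/eqP; rewrite -normr_le0.
  have cv : (fun n => K * `|\sum_(i < n) (a i - b i) *: x i|) @ \oo --> K * `|0 : X|.
    by apply: cvgM; [exact: cvg_cst|exact: cvg_norm].
  rewrite -(mulr0 K) -(@normr0 _ X); apply: (cvgr_to_ge cv).
  by exists m => // n /= mn; apply: (xK (fun i => a i - b i)).
have := d0 i.+1; rewrite big_ord_recr /= d0 add0r => /eqP.
by rewrite scaler_eq0 (negbTE (x_neq0 i)) orbF subr_eq0 => /eqP.
Qed.

End grunblum.

(** Compactness of the cube of coefficients turns pointwise convergence into uniform convergence,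
    because the functions are equi-Lipschitz. *)
Lemma ultra_uniform (R : realType) J (V : set_system J) (h : J -> (nat -> R) -> R)
    (N : nat) (L : R) :
  UltraFilter V ->
  (forall j t t', `|h j t - h j t'| <= L * \sum_(i < N) `|t i - t' i|) ->
  (forall t, (forall i, `|t i| <= 1) -> (fun j => h j t) @ V --> (0 : R)) ->
  forall e, 0 < e -> V [set j | forall t, (forall i, `|t i| <= 1) -> `|h j t| <= e].
Proof.
move=> UV hL h0 e e0; set A := [set j | _].
have [//|VCA] := in_ultra_setVsetC A UV.
(* If uniformity fails, pick a bad coefficient vector for each [j]; the limit [s] of these vectors
   along [V] contradicts convergence at [s]. *)
have /choice[tau tauP] : forall j, exists t : nat -> R,
    (forall i, `|t i| <= 1) /\ (~ A j -> e < `|h j t|).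
  move=> j; have [Aj|] := pselect (A j).
    by exists (fun=> 0); split => // i; rewrite normr0.
  move=> /existsNP[t /not_implyP[t1 /negP]]; rewrite -ltNge => ht.
  by exists t.
have tau1 i j : `|tau j i| <= 1 by exact: (tauP j).1.
pose s i := lim ((fun j => tau j i) @ V).
have scv i : (fun j => tau j i) @ V --> s i := ultra_bounded_cvg UV (tau1 i).
have s1 i : `|s i| <= 1.
  by apply: (cvgr_to_le (cvg_norm (scv i))); apply: filterE => j; exact: tau1.
have cv1 : (fun j => `|h j s|) @ V --> (0 : R).
  by rewrite -(@normr0 _ R); exact: (cvg_norm (h0 s s1)).
have cvs : (fun j => \sum_(i < N) `|tau j i - s i|) @ V --> \sum_(i < N) (0 : R).
  apply: (@cvg_sum_ord _ R _ V N (fun i j => `|tau j i - s i|) (fun=> 0)) => i _.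
  have -> : 0 = `|s i - s i| by rewrite subrr normr0.
  by apply: cvg_norm; apply: (@cvgB R R); [exact: scv|exact: cvg_cst].
have cv2 : (fun j => L * \sum_(i < N) `|tau j i - s i|) @ V --> L * 0.
  by apply: cvgM; [exact: cvg_cst|move: cvs; rewrite big1].
have := cvgD cv1 cv2; rewrite mulr0 addr0 => cv.
have Vlt : V [set j | `|h j s| + L * \sum_(i < N) `|tau j i - s i| < e].
  exact: (cvgr_lt _ (cv _) _ e0).
have [j [Aj je]] := filter_ex (filterI VCA Vlt).
have [_ /(_ Aj)] := tauP j; rewrite /= in je.
rewrite ltNge => /negP[]; apply: le_trans (ltW je).
by rewrite -[h j (tau j)](subrKC (h j s)) (le_trans (ler_normD _ _))// lerD2l.
Qed.

(** * Extraction of a spreading model along an ultrafilter *)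

Definition model_norm (R : realType) (X : normedModType R) J (V : set_system J)
    (v : J -> X) n (a : nat -> R) : R :=
  iter_norm V n (fun i j => a i *: v j) 0.

Lemma exists_history T (Q : seq T -> T -> Prop) : (forall h, exists j, Q h j) ->
  exists s : nat -> T, forall p, Q (mkseq s p) (s p).
Proof.
move=> /choice[f fQ]; pose hist p := iter p (fun h => rcons h (f h)) [::].
exists (fun p => f (hist p)) => p.
suff -> : mkseq (fun p => f (hist p)) p = hist p by [].
by elim: p => [//|p IH]; rewrite mkseqS IH.
Qed.

Section extraction.
Context {R : realType} {X : normedModType R} {J : Type}.
Variables (V : set_system J) (v : J -> X) (B : R).
Context {UV : UltraFilter V}.
Hypothesis B_ge0 : 0 <= B.
Hypothesis vB : forall j, `|v j| <= B.

Let zB (a : nat -> R) i j : `|a i *: v j| <= `|a i| * B.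
Proof. by rewrite normrZ ler_wpM2l. Qed.

Let combB (y : nat -> X) (d : nat -> R) p : (forall i, `|y i| <= B) ->
  `|\sum_(i < p) d i *: y i| <= B * \sum_(i < p) `|d i|.
Proof.
move=> yB; apply: (le_trans (ler_norm_sum _ _ _)); rewrite mulr_sumr.
by apply: ler_sum => i _; rewrite normrZ mulrC ler_wpM2r.
Qed.

Let iter_norm_coef_lipschitz p r (t t' : nat -> R) (w w' : X) :
  `|w - w'| <= B * \sum_(i < p) `|t i - t' i| ->
  `|iter_norm V r (fun i j => t (p + i)%N *: v j) w -
    iter_norm V r (fun i j => t' (p + i)%N *: v j) w'|
  <= B * \sum_(i < p + r) `|t i - t' i|.
Proof.
move=> ww'.
have dB i j : `|t (p + i)%N *: v j - t' (p + i)%N *: v j|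
    <= B * `|t (p + i)%N - t' (p + i)%N|.
  by rewrite -scalerBl normrZ mulrC ler_wpM2r.
apply: (le_trans (iter_norm_lipschitz r w w' (zB (fun i => t (p + i)%N))
  (zB (fun i => t' (p + i)%N)) dB)).
rewrite big_split_ord /= mulrDr lerD//.
by rewrite mulr_sumr.
Qed.

(** The error made when the outermost limit is replaced by its value at [j], with [p] vectors
    already fixed and [r] limits remaining. It is uniform in the coefficients, since these are
    unknown when [j] is chosen. *)
Let step_error_le (y : nat -> X) p r (e : R) (j : J) :=
  forall t : nat -> R, (forall i, `|t i| <= 1) ->
    `|iter_norm V r (fun i j => t (p.+1 + i)%N *: v j)
        (\sum_(i < p) t i *: y i + t p *: v j) -
      iter_norm V r.+1 (fun i j => t (p + i)%N *: v j) (\sum_(i < p) t i *: y i)| <= e.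

Lemma extraction_step (y : nat -> X) p r (e : R) : (forall i, `|y i| <= B) ->
  0 < e -> V (step_error_le y p r e).
Proof.
(* Each of the two iterated norms is [B]-Lipschitz in the coefficients, hence the constant
   [B + B]. *)
move=> yB; apply: (@ultra_uniform _ _ _ _ (p.+1 + r)%N (B + B)) => [j t t'|t t1].
  have sumB : \sum_(i < p) t i *: y i - \sum_(i < p) t' i *: y i
      = \sum_(i < p) (t i - t' i) *: y i.
    by rewrite -sumrB; apply: eq_bigr => i _; rewrite scalerBl.
  rewrite opprD opprK addrACA mulrDl (le_trans (ler_normD _ _))// lerD//.
    apply: iter_norm_coef_lipschitz => //.
    rewrite big_ord_recr /= mulrDr opprD addrACA sumB -scalerBl.
    rewrite (le_trans (ler_normD _ _))// lerD//.
      exact: (combB (fun i => t i - t' i)).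
    by rewrite normrZ mulrC ler_wpM2r.
  rewrite [- _ + _]addrC distrC addSnnS; apply: iter_norm_coef_lipschitz => //.
  by rewrite sumB; exact: (combB (fun i => t i - t' i)).
set u := \sum_(i < p) t i *: y i; set l := iter_norm V r.+1 _ u.
have cv := cvgB (iter_norm_cvg (V := V) r u (zB (fun i => t (p + i)%N))) (cvg_cst l).
rewrite subrr in cv; apply: cvg_trans (cv _ _ _); apply: near_eq_cvg; apply: filterE => j.
rewrite !fctE addn0; congr (iter_norm _ _ _ _ - _); apply/funext => i.
by rewrite addSnnS.
Qed.

(** Only finitely many [r], those with [r <= p], constrain the choice of term [p], so they can be
    met simultaneously. The sets [S p] carry side conditions imposed by the user of the
    extraction. *)
Lemma extraction (S : nat -> set J) (e : nat -> R) :
  (forall p, V (S p)) -> (forall p, 0 < e p) ->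
  exists s : nat -> J, (forall p, S p (s p)) /\
    forall p r (t : nat -> R), (r <= p)%N -> (forall i, `|t i| <= 1) ->
    `|iter_norm V r (fun i j => t (p.+1 + i)%N *: v j)
        (\sum_(i < p.+1) t i *: v (s i)) -
      iter_norm V r.+1 (fun i j => t (p + i)%N *: v j)
        (\sum_(i < p) t i *: v (s i))| <= e p.
Proof.
move=> VS e0.
pose Q (h : seq J) j := S (size h) j /\ forall r : 'I_(size h).+1,
  step_error_le (nth 0 (map v h)) (size h) r (e (size h)) j.
have [h|s sQ] := @exists_history J Q.
  have yB i : `|nth 0 (map v h) i| <= B.
    have [ih|hi] := ltnP i (size h); last by rewrite nth_default ?size_map// normr0.
    have [j _] := filter_ex (VS 0%N).
    by rewrite (nth_map j).
  apply: (@filter_ex _ V); apply: filterI => //.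
  apply: (@filter_forall J _
    (fun r : 'I_(size h).+1 => step_error_le (nth 0 (map v h)) (size h) r (e (size h)))).
  by move=> r; exact: extraction_step.
exists s; split => [p|p r t rp t1].
  by have [] := sQ p; rewrite size_mkseq.
have [_] := sQ p; rewrite size_mkseq => /(_ (Ordinal (rp : (r < p.+1)%N)) t t1) /=.
have -> : \sum_(i < p) t i *: nth 0 (map v (mkseq s p)) i
    = \sum_(i < p) t i *: v (s i).
  by apply: eq_bigr => i _; rewrite /mkseq -map_comp (nth_mkseq 0 (v \o s)).
by rewrite big_ord_recr.
Qed.

Variables (s : nat -> J) (e : nat -> R).
Hypothesis sP : forall p r (t : nat -> R), (r <= p)%N -> (forall i, `|t i| <= 1) ->
    `|iter_norm V r (fun i j => t (p.+1 + i)%N *: v j)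
        (\sum_(i < p.+1) t i *: v (s i)) -
      iter_norm V r.+1 (fun i j => t (p + i)%N *: v j)
        (\sum_(i < p) t i *: v (s i))| <= e p.

Section spreading.
Variables (n : nat) (a : nat -> R) (k : nat -> nat).
Hypothesis a1 : forall i, `|a i| <= 1.
Hypothesis nk : (n <= (k 0%N).+1)%N.
Hypothesis kmono : forall i, (i.+1 < n)%N -> (k i < k i.+1)%N.

Let k_lt i j : (i < j)%N -> (j < n)%N -> (k i < k j)%N.
Proof.
elim: j => [//|j IH]; rewrite ltnS leq_eqVlt => /predU1P[->|ij] jn; first exact: kmono.
exact: ltn_trans (IH ij (ltnW jn)) (kmono jn).
Qed.

(** Interpolates between the model norm, at [m = 0], and the norm of the actual sum, at [m = n]. *)
Let D m := iter_norm V (n - m) (fun i j => a (m + i)%N *: v j)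
  (\sum_(i < m) a i *: v (s (k i))).

Let D_step m : (m < n)%N -> `|D m.+1 - D m| <= e (k m).
Proof.
move=> mn; pose p := k m.
(* The coefficients of the vectors chosen before step p, followed by those of
   the terms still to be chosen. *)
pose t i := if (i < p)%N then \sum_(l < m | k l == i) a l else a (m + (i - p))%N.
(* As [k] is strictly increasing below [n], at most one [l] contributes to each [t i] with
   [i < p]. *)
have t1 i : `|t i| <= 1.
  rewrite /t; case: ifP => // _.
  have [[l kl]|h] := pselect (exists l : 'I_m, k l = i).
    suff kl_inj (l' : 'I_m) : (k l' == i) = (l' == l) by rewrite (big_pred1 l).
    apply/eqP/eqP => [kl'|->]; last exact: kl.
    have lt_mn (i' : 'I_m) : (i' < n)%N by exact: ltn_trans (ltn_ord i') mn.
    apply: val_inj; case: (ltngtP l' l) => // [lt|lt]; exfalso.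
      by have := k_lt lt (lt_mn _); rewrite kl kl' ltnn.
    by have := k_lt lt (lt_mn _); rewrite kl kl' ltnn.
  rewrite big1 ?normr0// => l /eqP kl; exfalso; apply: h.
  by exists l.
have tp i : t (p + i)%N = a (m + i)%N by rewrite /t ltnNge leq_addr/= addKn.
have sumt : \sum_(i < p) t i *: v (s i) = \sum_(i < m) a i *: v (s (k i)).
  transitivity (\sum_(i < p) \sum_(l < m | k l == i) a l *: v (s (k l))).
    apply: eq_bigr => i _; rewrite /t ltn_ord scaler_suml.
    by apply: eq_bigr => l /eqP ->.
  rewrite (exchange_big_dep predT)//=; apply: eq_bigr => l _.
  by rewrite (big_pred1 (Ordinal (k_lt (ltn_ord l) mn)))// => i; rewrite /= eq_sym.
(* The requirement that the first index be at least about [n] enters here: the number of limits left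
   does not exceed the position [p], as the extraction demands. *)
have rp : (n - m.+1 <= p)%N.
  have kp : (k 0%N <= p)%N.
    by case: (posnP m) => [m0|m0]; [rewrite /p m0|exact/ltnW/k_lt].
  by rewrite leq_subLR (leq_trans nk)// addSn ltnS (leq_trans kp)// leq_addl.
have sumt' : \sum_(i < p.+1) t i *: v (s i) = \sum_(i < m.+1) a i *: v (s (k i)).
  by rewrite !big_ord_recr /= sumt -[X in t X]addn0 tp addn0.
have := sP rp t1; rewrite sumt' sumt subnSK// /D.
have -> : (fun i j => t (p.+1 + i)%N *: v j) = (fun i j => a (m.+1 + i)%N *: v j).
  by apply/funext => i; rewrite addSnnS tp addSnnS.
suff -> : (fun i j => t (p + i)%N *: v j) = (fun i j => a (m + i)%N *: v j) by [].
by apply/funext => i; rewrite tp.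
Qed.

Lemma spreading_estimate :
  `| `|\sum_(i < n) a i *: v (s (k i))| - model_norm V v n a|
    <= \sum_(i < n) e (k i).
Proof.
suff H m : (m <= n)%N -> `|D m - D 0| <= \sum_(i < m) e (k i).
  by have := H n (leqnn n); rewrite /D subnn subn0 big_ord0.
elim: m => [|m IH] mn; first by rewrite subrr normr0 big_ord0.
rewrite -(subrKA (D m)) (le_trans (ler_normD _ _))// big_ord_recr addrC.
by rewrite lerD ?IH ?D_step// ltnW.
Qed.

End spreading.

Hypothesis vnull : weakly_null_along V v.

Lemma weakly_null_alongZ (c : R) : weakly_null_along V (fun j => c *: v j).
Proof.
move=> f flin fcont; have cv : (fun j => c * f (v j)) @ V --> c * 0.
  by apply: cvgM; [exact: cvg_cst|exact: vnull].
move: cv; rewrite mulr0; congr (_ @ V --> (0 : R)); apply/funext => j.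
by rewrite linear_functionalZ.
Qed.

Lemma model_norm_ge0 n a : 0 <= model_norm V v n a.
Proof. by have /(_ UV)/andP[] := iter_norm_bounds (V := V) n 0 (zB a). Qed.

Lemma model_norm_mono m n a : (m <= n)%N -> model_norm V v m a <= model_norm V v n a.
Proof.
by move=> mn; apply: (iter_norm_mono _ mn (zB a)) => i; exact: weakly_null_alongZ.
Qed.

(** With [r = 0], the extraction makes the norm after one more vector close to a one-term limit,
    which by weak nullity is at least the norm before it. The errors then add up. *)
Lemma partial_sum_le_add (t : nat -> R) m n : (forall i, `|t i| <= 1) -> (m <= n)%N ->
  `|\sum_(i < m) t i *: v (s i)| <= `|\sum_(i < n) t i *: v (s i)| + \sum_(m <= p < n) e p.
Proof.
move=> t1; elim: n => [|n IH]; first by rewrite leqn0 => /eqP ->; rewrite big_geq ?addr0.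
rewrite leq_eqVlt => /predU1P[->|]; first by rewrite big_geq ?addr0.
rewrite ltnS => mn; apply: (le_trans (IH mn)).
rewrite big_nat_recr//= addrA [leRHS]addrAC lerD2r.
have := @sP n 0 t (leq0n _) t1; rewrite [iter_norm V 0 _ _]/=.
rewrite ler_distl => /andP[h _]; rewrite -lerBlDr; apply: le_trans h.
rewrite lerD2r; apply: (@iter_norm_mono _ _ _ _ _ 0 1 _ _ _ _ (zB (fun i => t (n + i)%N))) => //.
by move=> i; exact: weakly_null_alongZ.
Qed.

End extraction.

Lemma exists_max_coef (R : realType) (a : nat -> R) n : (0 < n)%N ->
  exists2 q, (q < n)%N & forall i, (i < n)%N -> `|a i| <= `|a q|.
Proof.
elim: n => [//|[|n] IH] _; first by exists 0%N => // i; rewrite ltnS leqn0 => /eqP ->.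
have [//|q qn qmax] := IH.
have [h|/ltW h] := leP `|a n.+1| `|a q|.
  exists q; first exact: ltnW.
  by move=> i; rewrite ltnS leq_eqVlt => /predU1P[->//|]; exact: qmax.
exists n.+1 => // i; rewrite ltnS leq_eqVlt => /predU1P[->//|/qmax/le_trans]; exact.
Qed.

Section extraction_error.
Context {R : realType}.

(* Summable, with n * extraction_error (n - 1) -> 0: the first property makes the
   extracted sequence basic, the second controls the sums starting after n. *)
Definition extraction_error (p : nat) : R := (8 * p.+1%:R * p.+2%:R)^-1.

Lemma extraction_error_gt0 p : 0 < extraction_error p.
Proof. by rewrite invr_gt0 !mulr_gt0. Qed.

Let errorE p : extraction_error p = (8 * p.+1%:R)^-1 - (8 * p.+2%:R)^-1.
Proof.
rewrite /extraction_error -[p.+2%:R]natr1; field.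
by rewrite nat1r natr1 !pnatr_eq0.
Qed.

Lemma sum_extraction_error m n : (m <= n)%N ->
  \sum_(m <= p < n) extraction_error p <= 8^-1.
Proof.
move=> mn; apply: (@le_trans _ _ (8 * m.+1%:R)^-1).
  rewrite (@le_trans _ _ ((8 * m.+1%:R)^-1 - (8 * n.+1%:R)^-1))//; last first.
    by rewrite lerBlDr lerDl invr_ge0 mulr_ge0.
  elim: n mn => [|n IH]; first by rewrite leqn0 => /eqP ->; rewrite big_geq// subrr.
  rewrite leq_eqVlt => /predU1P[->|]; first by rewrite big_geq// subrr.
  rewrite ltnS => mn; rewrite big_nat_recr//= errorE.
  by rewrite -[leRHS](subrKA (8 * n.+1%:R)^-1) lerD2r IH.
by rewrite lef_pV2 ?posrE ?mulr_gt0// ler_pMr// ler1n.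
Qed.

Lemma sum_extraction_error_far n (k : nat -> nat) :
  (forall i, (i < n)%N -> (n <= (k i).+1)%N) ->
  \sum_(i < n) extraction_error (k i) <= (8 * n.+1%:R)^-1.
Proof.
case: n => [|n] nk; first by rewrite big_ord0 invr_ge0 mulr_ge0.
apply: (@le_trans _ _ (\sum_(i < n.+1) extraction_error n)).
  apply: ler_sum => i _; rewrite /extraction_error lef_pV2 ?posrE ?mulr_gt0//.
  have nki : (n <= k i)%N by rewrite -ltnS nk.
  by rewrite ler_pM ?mulr_ge0// ?ler_pM2l ?ler_nat ?ltnS.
rewrite big_const_ord iter_addr_0 -mulr_natr /extraction_error.
rewrite le_eqVlt; apply/orP; left; apply/eqP; rewrite -[n.+2%:R]natr1; field.
by rewrite nat1r natr1 !pnatr_eq0.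
Qed.

End extraction_error.

(** * Realizing the iterated norms by spreading models *)

Section spreading_model.
Context {R : realType} {X : normedModType R} {J : Type}.
Variables (V : set_system J) (v : J -> X).
Context {UV : UltraFilter V}.
Hypothesis v_le1 : forall j, `|v j| <= 1.
Hypothesis v_eq1 : V [set j | `|v j| = 1].
Hypothesis vnull : weakly_null_along V v.

Local Notation rho := (model_norm V v).

Let zB (a : nat -> R) i j : `|a i *: v j| <= `|a i| * 1.
Proof. by rewrite normrZ ler_wpM2l. Qed.

Lemma coef_le_model_norm n a i : (i < n)%N -> `|a i| <= rho n a.
Proof.
move=> ni; apply: (iter_norm_coef ni (zB a)).
  by move=> l; exact: weakly_null_alongZ.
by apply: filterS v_eq1 => j /= vj; rewrite normrZ vj mulr1.
Qed.

Lemma model_normZ n a (c : R) : rho n (fun i => c * a i) = `|c| * rho n a.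
Proof.
rewrite -(iter_normZ n 0 c (zB a)) scaler0; congr iter_norm.
by apply/funext => i; apply/funext => j; rewrite scalerA.
Qed.

Lemma model_normD n a b : rho n (fun i => a i + b i) <= rho n a + rho n b.
Proof.
have := iter_normD (V := V) n 0 0 (zB a) (zB b) => /(_ UV).
rewrite addr0; congr (_ <= _); congr iter_norm.
by apply/funext => i; apply/funext => j; rewrite scalerDl.
Qed.

Lemma eq_model_norm n a b : (forall i, (i < n)%N -> a i = b i) -> rho n a = rho n b.
Proof. by move=> ab; apply: eq_iter_norm => i j /ab ->. Qed.

Lemma model_norm_pad m n a : (m <= n)%N -> (forall i, (m <= i)%N -> a i = 0) ->
  rho n a = rho m a.
Proof.
move=> mn a0; rewrite /model_norm -(subnKC mn) iter_norm_pad// => i j mi.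
by rewrite a0// scale0r.
Qed.

(** Polynomials play the part of c_00, with the monomials as unit vectors; invariance under padding
    by zeros makes the seminorm independent of the length at which coefficients are read. *)
Lemma model_norm_realized : exists (Z : completeNormedModType R) (y : nat -> Z),
  forall n (a : nat -> R), `|\sum_(i < n) a i *: y i| = rho n a.
Proof.
pose G (p : {poly R}) := rho (size p) (nth 0 p).
have GE (p : {poly R}) n : (size p <= n)%N -> G p = rho n (nth 0 p).
  by move=> pn; rewrite (model_norm_pad pn)// => i pi; rewrite nth_default.
have [p q|c p|Z [T [Tlin TG]]] := @seminorm_embedding R {poly R} G.
- pose n := maxn (size p) (size q).
  rewrite (GE p n) ?leq_max ?leqnn// (GE q n) ?leq_max ?leqnn ?orbT//.
  rewrite (GE _ n) ?size_polyD//; apply: le_trans (model_normD _ _ _).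
  by rewrite le_eqVlt; apply/orP; left; apply/eqP/eq_model_norm => i _; rewrite coefD.
- rewrite (GE (c *: p) (size p)) ?size_scale_leq// -model_normZ.
  by apply: eq_model_norm => i _; rewrite coefZ.
exists Z, (fun i => T 'X^i) => n a.
have T0 : T 0 = 0 by apply/eqP; rewrite -normr_eq0 TG /G size_poly0 /model_norm /= normr0.
have -> : \sum_(i < n) a i *: T 'X^i = T (\poly_(i < n) a i).
  rewrite poly_def; elim: n => [|n IH]; first by rewrite !big_ord0.
  by rewrite !big_ord_recr /= IH addrC [in RHS]addrC Tlin.
rewrite TG (GE _ n) ?size_poly//; apply: eq_model_norm => i ni.
by rewrite coef_poly ni.
Qed.

Lemma spreading_model_extraction (S : nat -> set J) : (forall p, V (S p)) ->
  exists s : nat -> J, (forall p, S p (s p)) /\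
  exists (Z : completeNormedModType R) (y : nat -> Z),
    generates_spreading_model (fun p => v (s p)) y /\
    (forall a : seq R, `|comb y a| = rho (size a) (nth 0 a)).
Proof.
move=> VS.
have VS' p : V (S p `&` [set j | `|v j| = 1]) by exact: filterI.
have [s [Ss sP]] := extraction ler01 v_le1 VS' extraction_error_gt0.
exists s; split => [p|]; first by have [] := Ss p.
have vs1 p : `|v (s p)| = 1 by have [] := Ss p.
have [Z [y yE]] := model_norm_realized.
exists Z, y; split; last by move=> a; rewrite /comb yE.
split=> //; split.
  (* Scale the largest coefficient to 1. Truncation then costs at most 1/8 additively, and the two
     partial sums around that coefficient have norms adding up to at least 1. So the full sum has
     norm at least 3/8, and the constant 2 absorbs the 1/8. *)
  apply: (@grunblum_basic_seq _ _ _ 2) => //.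
    by move=> n; rewrite -normr_eq0 vs1 oner_eq0.
  move=> a m n mn; have [n0|n0] := posnP n.
    by move: mn; rewrite n0 leqn0 => /eqP ->; rewrite big_ord0 normr0 mulr0.
  have [q qn qmax] := exists_max_coef a n0.
  have [aq0|aq0] := eqVneq (a q) 0.
    rewrite big1 ?normr0 ?mulr_ge0// => i _; suff -> : a i = 0 by rewrite scale0r.
    apply/eqP; rewrite -normr_le0 -(@normr0 _ R) -aq0 qmax//.
    exact: leq_trans (ltn_ord i) mn.
  pose M := `|a q|; have M0 : 0 < M by rewrite normr_gt0.
  pose t i := if (i < n)%N then M^-1 * a i else 0.
  have t1 i : `|t i| <= 1.
    rewrite /t; case: ifP => [ni|]; last by rewrite normr0.
    by rewrite normrM normfV /M normr_id mulrC ler_pdivrMr// mul1r qmax.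
  have sumE l : (l <= n)%N ->
      \sum_(i < l) a i *: v (s i) = M *: \sum_(i < l) t i *: v (s i).
    move=> ln; rewrite scaler_sumr; apply: eq_bigr => i _.
    rewrite /t (leq_trans (ltn_ord i) ln) scalerA mulrA mulfV ?gt_eqF//.
    by rewrite mul1r.
  rewrite !sumE// !normrZ mulrCA ler_wpM2l//.
  have H l : (l <= n)%N -> `|\sum_(i < l) t i *: v (s i)|
      <= `|\sum_(i < n) t i *: v (s i)| + 8^-1.
    move=> ln; apply: le_trans (partial_sum_le_add v_le1 sP vnull t1 ln) _.
    by rewrite lerD2l sum_extraction_error.
  have : 1 <= `|\sum_(i < q.+1) t i *: v (s i)| + `|\sum_(i < q) t i *: v (s i)|.
    apply: le_trans (ler_normB _ _); rewrite big_ord_recr /= addrAC subrr add0r.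
    rewrite normrZ vs1 mulr1 /t qn normrM normfV /M normr_id mulVf//.
    by rewrite normr_eq0.
  have := H _ mn; have := H _ qn; have := H _ (ltnW qn).
  move=> ? ? ? ?; lra.
split.
  have y1 i : 1 <= `|y i|.
    pose d l : R := (l == i)%:R.
    have -> : y i = \sum_(l < i.+1) d l *: y l.
      rewrite big_ord_recr /= big1 ?add0r /d ?eqxx ?scale1r// => l _.
      by rewrite (ltn_eqF (ltn_ord l)) scale0r.
    rewrite yE; have := coef_le_model_norm d (ltnSn i).
    by rewrite /d eqxx normr1.
  apply: (@grunblum_basic_seq _ _ _ 1) => //.
    by move=> n; rewrite -normr_gt0 (lt_le_trans ltr01).
  move=> a m n mn; rewrite mul1r !yE.
  exact: (model_norm_mono v_le1 vnull).
exists (fun n => n.+1%:R^-1); split.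
  by move=> m n mn; rewrite lef_pV2 ?posrE// ler_nat.
split; first exact: cvg_harmonic.
move=> n a k sza _ nk kmono; rewrite /comb sza yE.
set N := `|_|; set r := rho n (nth 0 a).
have kge i : (i < n)%N -> (n <= (k i).+1)%N.
  elim: i => [//|i IH] ni; rewrite (leq_trans (IH (ltnW ni)))// ltnS.
  exact/ltnW/kmono.
(* Scaling by the model norm [r], which bounds every coefficient, turns the additive extraction
   error into a relative one. *)
have Nr : `|N - r| <= (8 * n.+1%:R)^-1 * r.
  have coef i : (i < n)%N -> `|a`_i| <= r by exact: coef_le_model_norm.
  have [r0|rn0] := eqVneq r 0.
    rewrite r0 mulr0 subr0 /N big1 ?normr0// => i _.
    suff -> : a`_i = 0 by rewrite scale0r.
    by apply/eqP; rewrite -normr_le0 (le_trans (coef i (ltn_ord i)))// r0.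
  have rgt0 : 0 < r.
    rewrite lt_neqAle eq_sym rn0.
    exact: (model_norm_ge0 v_le1).
  pose t i := if (i < n)%N then r^-1 * a`_i else 0.
  have t1 i : `|t i| <= 1.
    rewrite /t; case: ifP => [ni|]; last by rewrite normr0.
    by rewrite normrM normfV (gtr0_norm rgt0) mulrC ler_pdivrMr// mul1r coef.
  have := spreading_estimate sP t1 nk kmono.
  have -> : rho n t = 1.
    rewrite (@eq_model_norm _ _ (fun i => r^-1 * a`_i)); last by move=> i ni; rewrite /t ni.
    by rewrite model_normZ normfV gtr0_norm// mulVf.
  have -> : \sum_(i < n) t i *: v (s (k i)) = r^-1 *: \sum_(i < n) a`_i *: v (s (k i)).
    rewrite scaler_sumr; apply: eq_bigr => i _.
    by rewrite /t ltn_ord scalerA.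
  rewrite normrZ normfV (gtr0_norm rgt0) -/N => h.
  rewrite -ler_pdivrMr// -[X in _ / X](gtr0_norm rgt0) -normf_div mulrBl divff//.
  by rewrite mulrC; apply: le_trans h _; exact: sum_extraction_error_far.
have r0 : 0 <= r by exact: (model_norm_ge0 v_le1).
(* The relative error is [d / 8]. For [d <= 1] this leaves room for the reciprocal bound, as (1 +
   d)(1 - d/8) >= 1. *)
move: Nr; rewrite invfM; set d := n.+1%:R^-1 => Nr.
have d0 : 0 < d by rewrite invr_gt0.
have d1 : d <= 1 by rewrite invf_le1 ?ler1n.
have dr0 : 0 <= d * r by rewrite mulr_ge0// ltW.
have ddr : d * (d * r) <= d * r by rewrite ler_piMl.
move: Nr; rewrite ler_norml -mulrA => /andP[lo hi]; split; last first.
  by rewrite mulrDl mul1r; lra.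
rewrite ler_pdivrMl ?addr_gt0// mulrDl mul1r.
have : d * (r - 8^-1 * (d * r)) <= d * N by rewrite ler_pM2l//; lra.
rewrite mulrBr mulrCA => h; lra.
Qed.

End spreading_model.

(** * Block vectors *)

(** The Fubini sum of the [F k] along [U]: limits along it are iterated limits ([lim_bind]). *)
Definition bind_filter J K (U : set_system K) (F : K -> set_system J) : set_system J :=
  [set P | U [set k | F k P]].

Section bind_filter.
Context {J K : Type}.
Variables (U : set_system K) (F : K -> set_system J).
Hypotheses (UU : UltraFilter U) (UF : forall k, UltraFilter (F k)).

Lemma bind_ultra : UltraFilter (bind_filter U F).
Proof.
have bF : Filter (bind_filter U F).
  split.
  - by apply: (@filterE _ U) => k; exact: filterT.
  - move=> P Q UP UQ.
    by apply: (@filterS _ U _ _ _ _ (@filterI _ U _ _ _ UP UQ)) => k [FP FQ]; exact: filterI.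
  - by move=> P Q PQ; apply: (@filterS _ U) => k; exact: filterS.
apply: ultra_filterP.
  apply: Build_ProperFilter => h.
  have [k Fk0] := @filter_ex _ U _ _ h.
  exact: (@filter_not_empty _ (F k) _ Fk0).
move=> A; have [|UC] := in_ultra_setVsetC [set k | F k A] UU; first by left.
right; apply: (@filterS _ U _ _ _ _ UC) => k /= nFA.
by have [] := in_ultra_setVsetC A (UF k).
Qed.

Lemma lim_bind (R : realType) (g : J -> R) (M : R) : (forall j, `|g j| <= M) ->
  lim (g @ bind_filter U F) = lim ((fun k => lim (g @ F k)) @ U).
Proof.
move=> gM; have UB := bind_ultra.
have cF k : g @ F k --> lim (g @ F k) := ultra_bounded_cvg (UF k) gM.
have hM k : `|lim (g @ F k)| <= M.
  by apply: (cvgr_to_le (cvg_norm (cF k))); apply: filterE => j; exact: gM.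
have cU : (fun k => lim (g @ F k)) @ U --> lim ((fun k => lim (g @ F k)) @ U) :=
  ultra_bounded_cvg UU hM.
apply: cvg_lim => //; apply/cvgrPdist_le => e e0.
have e20 : 0 < e / 2 by rewrite divr_gt0.
move/cvgrPdist_le : cU => /(_ _ e20); apply: (@filterS _ U) => k hk.
move/cvgrPdist_le : (cF k) => /(_ _ e20); apply: filterS => j hj.
rewrite -(subrKA (lim (g @ F k))) (le_trans (ler_normD _ _))//; lra.
Qed.

End bind_filter.

Lemma convex_lipschitz_lim (R : realType) (X : normedModType R) J (V : set_system J)
    (z : J -> X) (B : R) (G : X -> R) :
  UltraFilter V -> (forall j, `|z j| <= B) -> convex_lipschitz G ->
  convex_lipschitz (fun y => lim ((fun j => G (y + z j)) @ V)).
Proof.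
move=> UV zB Gcl; have [cG [L L0 LG]] := Gcl.
have cv y : (fun j => G (y + z j)) @ V --> lim ((fun j => G (y + z j)) @ V) :=
  convex_lipschitz_cvg UV (convex_lipschitz_shift y Gcl) zB.
split.
  move=> s t x y s0 t0 st1.
  have cR : (fun j => s * G (x + z j) + t * G (y + z j)) @ V -->
      s * lim ((fun j => G (x + z j)) @ V) + t * lim ((fun j => G (y + z j)) @ V).
    by apply: cvgD; apply: cvgM; [exact: cvg_cst|exact: cv|exact: cvg_cst|exact: cv].
  apply: (le_cvg_to _ (cv _) cR) => j.
  have -> : s *: x + t *: y + z j = s *: (x + z j) + t *: (y + z j).
    by rewrite !scalerDr addrACA -scalerDl st1 scale1r.
  exact: cG.
exists L => // x y.
have cB := cvgB (cv x) (cv y).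
apply: (cvgr_to_le (cvg_norm (cB _))); apply: filterE => j.
by apply: (le_trans (LG _ _)); rewrite [y + _]addrC addrKA.
Qed.

Section block_sum.
Context {R : realType} {X : normedModType R}.
Implicit Types (w : nat -> R) (x : nat -> nat -> X) (l : seq nat).

Definition block_sum w x l : X := \sum_(m < size l) w m *: x m (nth 0%N l m).

Lemma block_sum_cons w x k l : block_sum w x (k :: l) =
  w 0%N *: x 0%N k + block_sum (fun m => w m.+1) (fun m => x m.+1) l.
Proof. by rewrite /block_sum big_ord_recl. Qed.

Lemma block_sumD w w' x l :
  block_sum (fun m => w m + w' m) x l = block_sum w x l + block_sum w' x l.
Proof. by rewrite -big_split; apply: eq_bigr => m _; rewrite scalerDl. Qed.

(** The constant [C] is left free for the induction: the shifted weights satisfy the same bound with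
    [C / 2]. *)
Lemma block_sum_le w x l (C : R) : (forall m, `|w m| <= C * 2^-1 ^+ m) ->
  (forall m k, `|x m k| <= 1) -> `|block_sum w x l| <= 2 * C.
Proof.
elim: l w x C => [|k l IH] w x C wC x1.
  have C0 : 0 <= C by have := wC 0%N; rewrite expr0 mulr1; apply: le_trans.
  by rewrite /block_sum big_ord0 normr0 mulr_ge0.
rewrite block_sum_cons (le_trans (ler_normD _ _))//.
have -> : 2 * C = C + 2 * (C / 2) by field.
rewrite lerD//; last first.
  by apply: IH => // m; rewrite -mulrA -exprS.
have := wC 0%N; rewrite expr0 mulr1; apply: le_trans.
by rewrite normrZ ler_piMr.
Qed.

Lemma block_sum_delta w x l n : block_sum (fun m => if m == n then w m else 0) x l =
  if (n < size l)%N then w n *: x n (nth 0%N l n) else 0.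
Proof.
rewrite /block_sum; case: ifP => nl; last first.
  rewrite big1// => m _; case: eqP => [mn|_]; last by rewrite scale0r.
  by move: (ltn_ord m); rewrite mn nl.
rewrite (bigD1 (Ordinal nl))//= eqxx big1 ?addr0// => m /eqP mn.
by case: eqP => [h|_]; [case: mn; exact: val_inj|rewrite scale0r].
Qed.

End block_sum.

(** * An ultrafilter on finite lists of indices *)

Section list_filter.
Variable U : set_system nat.
Context {UU : UltraFilter U}.

Fixpoint length_filter n : set_system (seq nat) :=
  if n is m.+1 then bind_filter U (fun k => (cons k) @ length_filter m)
  else principal_filter [::].

(** The length also tends to infinity along [U], so every given weight eventually occurs although
    each block is a finite sum. *)
Definition list_filter := bind_filter U length_filter.

Lemma length_filter_ultra n : UltraFilter (length_filter n).
Proof.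
elim: n => [|n IH]; first exact: principal_filter_ultra.
by apply: bind_ultra => // k; exact: ultra_fmap.
Qed.

Lemma list_filter_ultra : UltraFilter list_filter.
Proof. exact: bind_ultra UU length_filter_ultra. Qed.

Lemma list_filter_all (P : pred nat) : U [set k | P k] -> list_filter [set l | all P l].
Proof.
move=> UP; apply: (@filterE _ U) => n /=; elim: n => [|n IH]; first exact/principal_filterP.
apply: (@filterS _ U _ _ _ _ UP) => k /= Pk; have := length_filter_ultra n => Un.
by apply: (@filterS _ (length_filter n) _ _ _ _ IH) => l /= ->; rewrite Pk.
Qed.

Lemma list_filter_nth (P : set nat) m : (forall N, U [set k | (N <= k)%N]) ->
  U P -> list_filter [set l | (m < size l)%N /\ P (nth 0%N l m)].
Proof.
move=> Uge UP; apply: (@filterS _ U _ _ _ _ (Uge m.+1)) => n /=.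
elim: m n => [|m IH] [|n]// mn; have Un := length_filter_ultra n.
  by apply: (@filterS _ U _ _ _ _ UP) => k Pk /=; apply: (@filterE _ (length_filter n)) => l.
by apply: (@filterE _ U) => k /=; exact: IH.
Qed.

Section block_comparison.
Context {R : realType} {X : normedModType R}.
Implicit Types (w : nat -> R) (x : nat -> nat -> X) (l : seq nat) (G : X -> R).

Lemma lim_length_filterS (g : seq nat -> R) (M : R) n : (forall l, `|g l| <= M) ->
  lim (g @ length_filter n.+1) = lim ((fun k => lim ((fun l => g (k :: l)) @ length_filter n)) @ U).
Proof.
move=> gM; have Un := length_filter_ultra n.
by rewrite /= (lim_bind _ _ gM)// => k; exact: ultra_fmap.
Qed.

(** The tail is compared by induction, with [G] translated by the head of the block. The head is
    then either common to both sides or absent on the left, where weak nullity allows its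
    insertion. *)
Lemma lim_length_block_sum_mono n w w' x (C : R) G :
  (forall m, `|w m| <= C * 2^-1 ^+ m) -> (forall m, `|w' m| <= C * 2^-1 ^+ m) ->
  (forall m k, `|x m k| <= 1) -> (forall m, weakly_null_along U (x m)) ->
  (forall m, w m = w' m \/ w m = 0) -> convex_lipschitz G ->
  lim ((fun l => G (block_sum w x l)) @ length_filter n) <=
  lim ((fun l => G (block_sum w' x l)) @ length_filter n).
Proof.
elim: n w w' x C G => [|n IH] w w' x C G wC wC' x1 xnull ww' Gcl.
  have pE v : lim ((fun l => G (block_sum v x l)) @ length_filter 0) = G 0.
    have U0 := length_filter_ultra 0.
    apply: cvg_lim => //; apply/cvgrPdist_le => e e0; apply/principal_filterP.
    by rewrite /block_sum big_ord0 subrr normr0 ltW.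
  by rewrite !pE.
have [_ [L L0 LG]] := Gcl.
have Gb v (vC : forall m, `|v m| <= C * 2^-1 ^+ m) :=
  lipschitz_bounded L0 LG (fun l => block_sum_le l vC x1).
rewrite (lim_length_filterS _ (Gb _ wC)) (lim_length_filterS _ (Gb _ wC')).
have shiftC (v : nat -> R) : (forall m, `|v m| <= C * 2^-1 ^+ m) ->
    forall m, `|v m.+1| <= (C / 2) * 2^-1 ^+ m.
  by move=> vC m; rewrite -mulrA -exprS.
have Un := length_filter_ultra n.
have zB l := block_sum_le l (shiftC _ wC') (fun m => x1 m.+1).
(* [G] averaged over the tail, as a function of the head: again convex Lipschitz, so it may serve as
   a test functional. *)
pose H y := lim ((fun l => G (y + block_sum (fun m => w' m.+1) (fun m => x m.+1) l))
  @ length_filter n).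
have Hcl : convex_lipschitz H := convex_lipschitz_lim Un zB Gcl.
have xB (c : R) k : `|c *: x 0%N k| <= `|c| by rewrite normrZ ler_piMr.
have cvH (c : R) : (fun k => H (c *: x 0%N k)) @ U --> lim ((fun k => H (c *: x 0%N k)) @ U).
  exact: (convex_lipschitz_cvg UU Hcl (xB c)).
have -> : (fun k => lim ((fun l => G (block_sum w' x (k :: l))) @ length_filter n))
    = (fun k => H (w' 0%N *: x 0%N k)).
  apply/funext => k; rewrite /H.
  by under eq_fun do rewrite block_sum_cons.
apply: (@le_trans _ _ (lim ((fun k => H (w 0%N *: x 0%N k)) @ U))).
  have bnd k : `|lim ((fun l => G (block_sum w x (k :: l))) @ length_filter n)|
      <= `|G 0| + L * (2 * C).
    have gb l := Gb _ wC (k :: l).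
    have cv : (fun l => G (block_sum w x (k :: l))) @ length_filter n -->
       lim ((fun l => G (block_sum w x (k :: l))) @ length_filter n) :=
       ultra_bounded_cvg Un gb.
    by apply: (cvgr_to_le (cvg_norm cv)); apply: filterE.
  apply: (le_cvg_to _ (ultra_bounded_cvg UU bnd) (cvH _)) => k.
  have := IH _ _ _ _ _ (shiftC _ wC) (shiftC _ wC') (fun m => x1 m.+1)
    (fun m => xnull m.+1) (fun m => ww' m.+1) (convex_lipschitz_shift (w 0%N *: x 0%N k) Gcl).
  by under [in X in X -> _]eq_fun do rewrite -block_sum_cons.
have [->//|->] := ww' 0%N.
have -> : (fun k => H (0 *: x 0%N k)) = (fun=> H 0) by apply/funext => k; rewrite scale0r.
rewrite lim_cst//.
have wnull : weakly_null_along U (fun k => w' 0%N *: x 0%N k).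
  exact: weakly_null_alongZ.
have := weakly_null_le_lim 0 UU Hcl (xB (w' 0%N)) wnull.
by under eq_fun do rewrite add0r.
Qed.

Lemma lim_block_sum_mono w w' x (C : R) G :
  (forall m, `|w m| <= C * 2^-1 ^+ m) -> (forall m, `|w' m| <= C * 2^-1 ^+ m) ->
  (forall m k, `|x m k| <= 1) -> (forall m, weakly_null_along U (x m)) ->
  (forall m, w m = w' m \/ w m = 0) -> convex_lipschitz G ->
  lim ((fun l => G (block_sum w x l)) @ list_filter) <=
  lim ((fun l => G (block_sum w' x l)) @ list_filter).
Proof.
move=> wC wC' x1 xnull ww' Gcl; have [_ [L L0 LG]] := Gcl.
have Gb v (vC : forall m, `|v m| <= C * 2^-1 ^+ m) :=
  lipschitz_bounded L0 LG (fun l => block_sum_le l vC x1).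
rewrite (lim_bind _ length_filter_ultra (Gb _ wC)) (lim_bind _ length_filter_ultra (Gb _ wC')).
have cv v (vC : forall m, `|v m| <= C * 2^-1 ^+ m) :
    cvg ((fun n => lim ((fun l => G (block_sum v x l)) @ length_filter n)) @ U).
  apply: (@ultra_bounded_cvg _ _ _ _ (`|G 0| + L * (2 * C))) => n.
  have Un := length_filter_ultra n.
  have c1 : (fun l => G (block_sum v x l)) @ length_filter n -->
      lim ((fun l => G (block_sum v x l)) @ length_filter n) :=
    ultra_bounded_cvg Un (Gb _ vC).
  by apply: (cvgr_to_le (cvg_norm c1)); apply: filterE; exact: Gb.
apply: (le_cvg_to _ (cv _ wC) (cv _ wC')) => n.
exact: (lim_length_block_sum_mono n wC wC').
Qed.

Lemma lim_block_sum_delta w x G n : (forall N, U [set k | (N <= k)%N]) ->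
  (forall m k, `|x m k| <= 1) -> convex_lipschitz G ->
  lim ((fun l => G (block_sum (fun m => if m == n then w m else 0) x l)) @ list_filter) =
  lim ((fun k => G (w n *: x n k)) @ U).
Proof.
move=> Uge x1 Gcl; have UL := list_filter_ultra.
have xB k : `|w n *: x n k| <= `|w n| by rewrite normrZ ler_piMr.
have cv : (fun k => G (w n *: x n k)) @ U --> lim ((fun k => G (w n *: x n k)) @ U) :=
  convex_lipschitz_cvg UU Gcl xB.
apply: cvg_lim => //; apply/cvgrPdist_le => e e0.
move/cvgrPdist_le : cv => /(_ _ e0) Ue.
have := list_filter_nth n Uge Ue; apply: filterS => l [nl /= h].
by rewrite block_sum_delta nl.
Qed.

End block_comparison.

End list_filter.

Section block_weakly_null.
Context {R : realType} {X : normedModType R}.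
Implicit Types (w : nat -> R) (x : nat -> nat -> X) (l : seq nat).

Lemma continuous_functional_bounded (f : X -> R) : is_linear_functional f ->
  continuous f -> exists2 L : R, 0 <= L & forall y, `|f y| <= L * `|y|.
Proof.
move=> flin fcont.
have f0 := linear_functional0 flin.
have /cvgrPdist_le/(_ 1 ltr01) := fcont 0; rewrite f0 => /nbhs_ballP[d /= d0 dP].
exists (2 / d) => [|y]; first by rewrite divr_ge0// ltW.
have [->|y0] := eqVneq y 0; first by rewrite f0 !normr0 mulr0.
have ny : 0 < `|y| by rewrite normr_gt0.
pose c := d / 2 / `|y|; have c0 : 0 < c by rewrite !divr_gt0.
have : `|0 - f (c *: y)| <= 1.
  apply: dP; rewrite -ball_normE /ball_ /= sub0r normrN normrZ gtr0_norm//.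
  by rewrite /c divfK ?gt_eqF//; lra.
rewrite sub0r normrN linear_functionalZ// normrM gtr0_norm// -ler_pdivlMl// mulr1 => /le_trans; apply.
rewrite le_eqVlt; apply/orP; left; apply/eqP; rewrite /c; field.
by rewrite !gt_eqF.
Qed.

(** The bound is uniform over all lists with large entries, whatever their length: the geometric
    weights control the tail and weak nullity controls the finitely many remaining terms. This
    transfers weak nullity to extracted sequences. *)
Lemma block_sum_functional_small w x (C : R) (f : X -> R) :
  is_linear_functional f -> continuous f ->
  (forall m, `|w m| <= C * 2^-1 ^+ m) -> (forall m k, `|x m k| <= 1) ->
  (forall m, weakly_null (x m)) -> forall e, 0 < e ->
  exists K : nat, forall l, all (leq K) l -> `|f (block_sum w x l)| <= e.
Proof.
move=> flin fcont wC x1 xnull e e0.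
have [L L0 fL] := continuous_functional_bounded flin fcont.
have f0 := linear_functional0 flin.
(* Induction on the number [N] of leading terms treated by weak nullity; each one takes half of the
   available error, and halving [C] produces the factor [2^-1 ^+ N]. *)
have H N : forall w x (C : R), (forall m, `|w m| <= C * 2^-1 ^+ m) ->
    (forall m k, `|x m k| <= 1) -> (forall m, weakly_null (x m)) ->
    forall e, 0 < e -> exists K : nat, forall l, all (leq K) l ->
      `|f (block_sum w x l)| <= e + L * (2 * C) * 2^-1 ^+ N.
  elim: N => [|N IH] {}w {}x {}C {}wC {}x1 {}xnull {}e {}e0.
    exists 0%N => l _; rewrite expr0 mulr1; apply: (le_trans (fL _)).
    by apply: ler_wpDl; [exact: ltW|rewrite ler_wpM2l// block_sum_le].
  have e20 : 0 < e / 2 by rewrite divr_gt0.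
  have wC' m : `|w m.+1| <= C / 2 * 2^-1 ^+ m by rewrite -mulrA -exprS.
  have [K1 K1P] := IH (fun m => w m.+1) (fun m => x m.+1) (C / 2) wC'
    (fun m => x1 m.+1) (fun m => xnull m.+1) _ e20.
  have cv : (fun k => w 0%N * f (x 0%N k)) @ \oo --> w 0%N * 0.
    by apply: cvgM; [exact: cvg_cst|exact: xnull].
  move/cvgrPdist_le : cv => /(_ _ e20)[K0 _ K0P].
  exists (maxn K0 K1) => -[|k l].
    move=> _; rewrite /block_sum big_ord0 f0 normr0.
    have C0 : 0 <= C by have := wC 0%N; rewrite expr0 mulr1; apply: le_trans.
    apply: addr_ge0; first exact: ltW.
    by apply: mulr_ge0; [rewrite !mulr_ge0|rewrite exprn_ge0 ?invr_ge0].
  rewrite /= geq_max => /andP[/andP[k0 _] Kl].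
  rewrite block_sum_cons flin.
  have h0 := K0P k k0; rewrite /= mulr0 sub0r normrN in h0.
  have h1 := K1P l; rewrite exprS.
  have -> : e + L * (2 * C) * (2^-1 * 2^-1 ^+ N) =
      e / 2 + (e / 2 + L * (2 * (C / 2)) * 2^-1 ^+ N) by field.
  rewrite (le_trans (ler_normD _ _))// lerD// h1//.
  by apply: sub_all Kl => i; apply: leq_trans; exact: leq_maxr.
have e20 : 0 < e / 2 by rewrite divr_gt0.
have cv : (fun N => L * (2 * C) * 2^-1 ^+ N) @ \oo --> L * (2 * C) * 0.
  apply: cvgM; first exact: cvg_cst.
  by apply: cvg_expr; rewrite ger0_norm ?invr_ge0// invf_lt1// ltr1n.
move/cvgrPdist_le : cv => /(_ _ e20)/filter_ex[N].
rewrite mulr0 sub0r normrN => hN.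
have [K KP] := H N _ _ _ wC x1 xnull _ e20; exists K => l /KP /le_trans; apply.
have := le_trans (ler_norm _) hN; lra.
Qed.

End block_weakly_null.

(** * Comparison of model norms *)

Section model_norm_comparison.
Context {R : realType} {X : normedModType R}.

Lemma convex_lipschitz_scale (G : X -> R) (c : R) : convex_lipschitz G ->
  convex_lipschitz (fun y => G (c *: y)).
Proof.
move=> [cG [L L0 LG]]; split => [s t x y s0 t0 st1|].
  by rewrite scalerDr !scalerA !(mulrC c) -!scalerA; exact: cG.
exists (L * `|c|); first exact: mulr_ge0.
by move=> x y; rewrite (le_trans (LG _ _))// -scalerBr normrZ mulrA.
Qed.

Lemma model_norm_le_comparison J J' (V : set_system J) (V' : set_system J')
    (v : J -> X) (v' : J' -> X) (B B' : R) n a :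
  UltraFilter V -> UltraFilter V' ->
  (forall j, `|v j| <= B) -> (forall j, `|v' j| <= B') ->
  (forall G : X -> R, convex_lipschitz G ->
    lim ((fun j => G (v j)) @ V) <= lim ((fun j => G (v' j)) @ V')) ->
  model_norm V v n a <= model_norm V' v' n a.
Proof.
move=> UV UV' vB vB' H.
apply: (@iter_norm_le_comparison _ _ _ _ _ _ _ _ _ (fun i => `|a i| * B)
  (fun i => `|a i| * B')) => //.
- by move=> i j; rewrite normrZ ler_wpM2l.
- by move=> i j; rewrite normrZ ler_wpM2l.
by move=> i G /(convex_lipschitz_scale (a i)) /H.
Qed.

Lemma model_norm_scale J (V : set_system J) (v : J -> X) (B : R) (c : R) n a :
  UltraFilter V -> (forall j, `|v j| <= B) ->
  model_norm V (fun j => c *: v j) n a = `|c| * model_norm V v n a.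
Proof.
move=> UV vB.
have zB i j : `|a i *: v j| <= `|a i| * B by rewrite normrZ ler_wpM2l.
rewrite -(iter_normZ n 0 c zB) scaler0; congr iter_norm.
by apply/funext => i; apply/funext => j; rewrite !scalerA mulrC.
Qed.

Lemma model_norm_add J (V : set_system J) (v v' : J -> X) (B B' : R) n a :
  UltraFilter V -> (forall j, `|v j| <= B) -> (forall j, `|v' j| <= B') ->
  model_norm V (fun j => v j + v' j) n a <= model_norm V v n a + model_norm V v' n a.
Proof.
move=> UV vB vB'.
have zB i j : `|a i *: v j| <= `|a i| * B by rewrite normrZ ler_wpM2l.
have zB' i j : `|a i *: v' j| <= `|a i| * B' by rewrite normrZ ler_wpM2l.
have := iter_normD (V := V) n 0 0 zB zB' => /(_ UV).
rewrite addr0; congr (_ <= _); congr iter_norm.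
by apply/funext => i; apply/funext => j; rewrite scalerDr.
Qed.

Lemma model_norm_le_l1 J (V : set_system J) (v : J -> X) (B : R) n a :
  UltraFilter V -> (forall j, `|v j| <= B) ->
  model_norm V v n a <= B * \sum_(i < n) `|a i|.
Proof.
move=> UV vB.
have zB i j : `|a i *: v j| <= `|a i| * B by rewrite normrZ ler_wpM2l.
have /(_ UV)/andP[_] := iter_norm_bounds (V := V) n 0 zB.
by rewrite normr0 add0r -mulr_suml mulrC.
Qed.

Lemma lim_lipschitz_eq J (V : set_system J) (z z' : J -> X) (B : R) (G : X -> R) :
  UltraFilter V -> (forall j, `|z j| <= B) ->
  (fun j => `|z' j - z j|) @ V --> (0 : R) ->
  convex_lipschitz G ->
  lim ((fun j => G (z' j)) @ V) = lim ((fun j => G (z j)) @ V).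
Proof.
move=> UV zB zz' Gcl; have [_ [L L0 LG]] := Gcl.
have cz : (fun j => G (z j)) @ V --> lim ((fun j => G (z j)) @ V) :=
  convex_lipschitz_cvg UV Gcl zB.
apply: cvg_lim => //; apply/cvgrPdist_le => e e0.
have e20 : 0 < e / 2 by rewrite divr_gt0.
have Ll : (fun j => L * `|z' j - z j|) @ V --> L * 0.
  by apply: cvgM; [exact: cvg_cst|].
move/cvgrPdist_le : cz => /(_ _ e20) V1.
move/cvgrPdist_le : Ll => /(_ _ e20) V2.
apply: filterS (filterI V1 V2) => j [h1 h2].
rewrite -(subrKA (G (z j))) (le_trans (ler_normD _ _))//.
have -> : e = e / 2 + e / 2 by lra.
rewrite lerD// distrC (le_trans (LG _ _))//.
by move: h2; rewrite mulr0 sub0r normrN ger0_norm// mulr_ge0.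
Qed.

End model_norm_comparison.

(** * Recovering a given spreading model from iterated limits *)

Section spreading_model_norm.
Context {R : realType} {X : normedModType R}.
Variables (U : set_system nat).
Context {UU : UltraFilter U}.
Hypothesis Uge : forall N, U [set k | (N <= k)%N].

Lemma weakly_null_along_ultra (x : nat -> X) : weakly_null x -> weakly_null_along U x.
Proof.
move=> xnull f flin fcont; apply/cvgrPdist_le => e e0.
move/cvgrPdist_le : (xnull f flin fcont) => /(_ _ e0)[N _ NP].
by apply: filterS (Uge N) => k /= Nk; exact: NP.
Qed.

Lemma iter_norm_far (x : nat -> X) n (b : nat -> R) u N (r e : R) :
  (forall k, `|x k| <= 1) ->
  (forall k : nat -> nat, (N <= k 0%N)%N -> (forall i, (k i < k i.+1)%N) ->
    `| `|u + \sum_(i < n) b i *: x (k i)| - r| <= e) ->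
  `|iter_norm U n (fun i j => b i *: x j) u - r| <= e.
Proof.
move=> x1; elim: n b u N => [|n IH] b u N H.
  have := H (fun i => (N + i)%N); rewrite big_ord0 !addr0 addn0; apply => // i.
  by rewrite addnS.
have zB i j : `|b i *: x j| <= `|b i| * 1 by rewrite normrZ ler_wpM2l.
have cB := cvgB (iter_norm_cvg (V := U) n u zB) (cvg_cst r).
apply: (cvgr_to_le (cvg_norm (cB _ _ _))).
apply: filterS (Uge N) => k0 /= Nk0.
(* The threshold rises to [k0.+1], so that prepending [k0] keeps the indices strictly increasing. *)
apply: (IH (fun i => b i.+1) _ k0.+1) => k k0k kS.
have := H (fun i => if i is j.+1 then k j else k0) Nk0.
by rewrite big_ord_recl /= addrA; apply => -[|i].
Qed.

(** A sum of [n] terms is only controlled up to [eps n]. Padding it with zero coefficients to length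
    [N] and moving the indices beyond [N] replaces this by [eps N], which tends to 0, so equality
    holds. *)
Lemma model_norm_spreading_model (Y : normedModType R) (x : nat -> X) (xt : nat -> Y)
    n (a : nat -> R) : generates_spreading_model x xt ->
  model_norm U x n a = `|\sum_(i < n) a i *: xt i|.
Proof.
move=> [xn [_ [_ [eps [eps_dec [eps0 epsP]]]]]].
have x1 k : `|x k| <= 1 by rewrite xn.
(* Scaling by [M] brings the coefficients into [-1, 1]. *)
pose M := 1 + \sum_(i < n) `|a i|.
have M0 : 0 < M by rewrite ltr_wpDr// sumr_ge0.
pose b i := if (i < n)%N then M^-1 * a i else 0.
have b1 i : `|b i| <= 1.
  rewrite /b; case: ifP => [ni|_]; last by rewrite normr0.
  rewrite normrM normfV (gtr0_norm M0) mulrC ler_pdivrMr// mul1r /M.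
  rewrite (bigD1 (Ordinal ni))//= addrCA lerDl addr_ge0// sumr_ge0//.
have b0 i : (n <= i)%N -> b i = 0 by rewrite /b ltnNge => ->.
suff H : model_norm U x n b = `|\sum_(i < n) b i *: xt i|.
  have Mn0 : M != 0 by rewrite gt_eqF.
  have Mb i : (i < n)%N -> a i = M * b i.
    by move=> ni; rewrite /b ni mulrA mulfV// mul1r.
  rewrite (eq_model_norm _ _ Mb) model_normZ// H.
  have -> : \sum_(i < n) a i *: xt i = M *: \sum_(i < n) b i *: xt i.
    by rewrite scaler_sumr; apply: eq_bigr => i _; rewrite scalerA -Mb.
  by rewrite normrZ.
set r := `|_|.
have eps_ge0 N : 0 <= eps N.
  apply: (cvgr_to_le eps0); exists N => // k /= Nk; exact: eps_dec.
have pad (Z : normedModType R) (y : nat -> Z) N : (n <= N)%N ->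
    comb y (mkseq b N) = \sum_(i < n) b i *: y i.
  move=> nN; rewrite /comb size_mkseq -(subnKC nN) big_split_ord /= [X in _ + X]big1.
    rewrite addr0; apply: eq_bigr => i _; rewrite nth_mkseq//.
    by rewrite (leq_trans (ltn_ord i))// leq_addr.
  by move=> i _; rewrite nth_mkseq ?ltn_add2l// b0 ?leq_addr// scale0r.
apply/eqP; rewrite -subr_eq0 -normr_le0; apply/ler_addgt0Pr => e e0; rewrite add0r.
have cr : (fun N => eps N * r) @ \oo --> 0 * r by apply: cvgM => //; exact: cvg_cst.
move/cvgrPdist_le : cr => /(_ _ e0)[N0 _ N0P].
pose N := maxn n N0.
have Ne : eps N * r <= e.
  have := N0P N (leq_maxr _ _); rewrite /= mul0r sub0r normrN.
  by apply: le_trans; exact: ler_norm.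
apply: (@iter_norm_far x n b 0 N) => // k Nk kS; rewrite add0r.
have [|i|||lo hi] := epsP N (mkseq b N) k.
- by rewrite size_mkseq.
- by move=> iN; rewrite nth_mkseq// -ler_norml.
- exact: leqW.
- by move=> i _; exact: kS.
move: lo hi; rewrite !pad ?leq_maxl// -/r => lo hi.
have r0 : 0 <= r by rewrite /r.
rewrite ler_norml; apply/andP; split; last first.
  by rewrite lerBlDl (le_trans hi)// mulrDl mul1r lerD2l.
rewrite lerBrDl; apply: le_trans lo.
rewrite ler_pdivlMl ?ltr_wpDr//; have := eps_ge0 N => en.
have h1 : eps N * (r - eps N * r) <= eps N * r.
  by rewrite ler_wpM2l// lerBlDr lerDl mulr_ge0.
apply: (@le_trans _ _ ((1 + eps N) * (r - eps N * r))).
  by rewrite ler_wpM2l ?addr_ge0// lerD2l lerN2.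
rewrite mulrDl mul1r; lra.
Qed.

End spreading_model_norm.

(** * Spreading models of block vectors *)

Section block_model.
Context {R : realType} {X : normedModType R}.
Variables (U : set_system nat) (x : nat -> nat -> X).
Context {UU : UltraFilter U}.
Hypothesis Uge : forall N, U [set k | (N <= k)%N].
Hypothesis x1 : forall m k, `|x m k| <= 1.
Hypothesis xnull : forall m, weakly_null (x m).

Local Notation L := (list_filter U).
Local Notation rho w := (model_norm L (block_sum w x)).

#[local] Instance UL : UltraFilter L. Proof. exact: list_filter_ultra. Qed.
Let xnullU m : weakly_null_along U (x m). Proof. exact: weakly_null_along_ultra. Qed.

Lemma block_model_mono w w' (C : R) n a :
  (forall m, `|w m| <= C * 2^-1 ^+ m) -> (forall m, `|w' m| <= C * 2^-1 ^+ m) ->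
  (forall m, w m = w' m \/ w m = 0) -> rho w n a <= rho w' n a.
Proof.
move=> wC wC' ww'.
apply: (model_norm_le_comparison _ _ UL UL (fun l => block_sum_le l wC x1)
  (fun l => block_sum_le l wC' x1)) => G Gcl.
exact: (lim_block_sum_mono wC wC').
Qed.

Let delta_le w m l : `|block_sum (fun i => if i == m then w i else 0) x l| <= `|w m|.
Proof.
rewrite block_sum_delta; case: ifP => _; last by rewrite normr0.
by rewrite normrZ ler_piMr.
Qed.

Lemma block_model_delta w m n a :
  rho (fun i => if i == m then w i else 0) n a = `|w m| * model_norm U (x m) n a.
Proof.
have sB k : `|w m *: x m k| <= `|w m| by rewrite normrZ ler_piMr.
rewrite -(model_norm_scale (w m) n a UU (x1 m)).
apply/eqP; rewrite eq_le; apply/andP; split.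
  apply: (model_norm_le_comparison _ _ UL UU (delta_le w m) sB) => G Gcl.
  by rewrite (lim_block_sum_delta _ _ Uge).
apply: (model_norm_le_comparison _ _ UU UL sB (delta_le w m)) => G Gcl.
by rewrite (lim_block_sum_delta _ _ Uge).
Qed.

Lemma block_sum_tail_le w l M (T : R) : (forall m, (m < M)%N -> w m = 0) ->
  (forall m, `|w (M + m)%N| <= T * 2^-1 ^+ m) -> `|block_sum w x l| <= 2 * T.
Proof.
suff H (y : nat -> nat -> X) : (forall m k, `|y m k| <= 1) -> (forall m, (m < M)%N -> w m = 0) ->
  (forall m, `|w (M + m)%N| <= T * 2^-1 ^+ m) -> `|block_sum w y l| <= 2 * T by exact: H.
elim: M w y l => [|M IH] w y l y1 w0 wT; first exact: (@block_sum_le _ _ w y l T wT y1).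
have T0 : 0 <= T by have := wT 0%N; rewrite expr0 mulr1; apply: le_trans.
case: l => [|k l]; first by rewrite /block_sum big_ord0 normr0 mulr_ge0.
rewrite block_sum_cons w0// scale0r add0r.
by apply: IH => // m mM; exact: w0.
Qed.

(** The weights before [M] are split off one by one, each contributing its own model norm; the tail
    of the block enters only through its length and the l1 norm of [a]. *)
Lemma block_model_le w (C T : R) M n a : (forall m, `|w m| <= C * 2^-1 ^+ m) ->
  (forall m, `|w (M + m)%N| <= T * 2^-1 ^+ m) ->
  rho w n a <= \sum_(m < M) `|w m| * model_norm U (x m) n a
               + 2 * T * \sum_(i < n) `|a i|.
Proof.
move=> wC wT.
pose head N m := if (m < N)%N then w m else 0.
pose tail m := if (m < M)%N then 0 else w m.
have hC N m : `|head N m| <= C * 2^-1 ^+ m.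
  by rewrite /head; case: ifP => // _; rewrite normr0 (le_trans _ (wC m)).
have tT l : `|block_sum tail x l| <= 2 * T.
  apply: (@block_sum_tail_le _ _ M) => m; first by rewrite /tail => ->.
  by rewrite /tail ltnNge leq_addr /=; exact: wT.
have -> : block_sum w x = (fun l => block_sum (head M) x l + block_sum tail x l).
  apply/funext => l; rewrite -block_sumD; apply: eq_bigr => m _.
  by rewrite /head /tail; case: ifP; rewrite ?addr0 ?add0r.
apply: (le_trans (model_norm_add _ _ UL (fun l => block_sum_le l (hC M) x1) tT)).
apply: lerD; last exact: model_norm_le_l1.
elim: M {tail tT wT} => [|N IH].
  rewrite big_ord0 /model_norm.
  have h0 l : `|block_sum (head 0%N) x l| <= 0.
    by rewrite /block_sum big1 ?normr0// => m _; rewrite /head scale0r.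
  by apply: (le_trans (model_norm_le_l1 _ _ UL h0)); rewrite mul0r.
rewrite big_ord_recr /= -block_model_delta.
have -> : block_sum (head N.+1) x = (fun l => block_sum (head N) x l +
    block_sum (fun i => if i == N then w i else 0) x l).
  apply/funext => l; rewrite -block_sumD; apply: eq_bigr => m _; congr (_ *: _).
  by rewrite /head ltnS leq_eqVlt; case: (ltngtP m N); rewrite ?addr0 ?add0r.
apply: (le_trans (model_norm_add _ _ UL (fun l => block_sum_le l (hC N) x1) (delta_le w N))).
by rewrite lerD2r.
Qed.

Lemma block_weakly_null_along w (C : R) : (forall m, `|w m| <= C * 2^-1 ^+ m) ->
  weakly_null_along L (block_sum w x).
Proof.
move=> wC f flin fcont; apply/cvgrPdist_le => e e0.
have [K KP] := block_sum_functional_small flin fcont wC x1 xnull e0.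
apply: filterS (list_filter_all (Uge K)) => l /KP.
by rewrite sub0r normrN.
Qed.

(** The blocks must be normalized by their own norms. These norms tend to a limit [c > 0], so the
    model norm merely acquires the factor [c^-1]. *)
Lemma block_spreading_model w (C : R) m0 :
  (forall m, `|w m| <= C * 2^-1 ^+ m) -> (forall k, `|x m0 k| = 1) -> w m0 != 0 ->
  exists (Z : completeNormedModType R) (y : nat -> Z),
    weakly_null_spreading_model X y /\
    exists2 c : R, 0 < c & forall a : seq R,
      `|comb y a| = c * rho w (size a) (nth 0 a).
Proof.
move=> wC xm0 wm0; pose v := block_sum w x.
have vB l : `|v l| <= 2 * C by exact: block_sum_le.
have cn : (fun l => `|v l|) @ L --> lim ((fun l => `|v l|) @ L).
  apply: (@ultra_bounded_cvg _ _ _ _ (2 * C) UL) => l.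
  by rewrite normr_id.
set c := lim _ in cn.
(* Dropping every weight but the one at [m0] can only lower the limit, and leaves [|w m0|]. *)
have c0 : 0 < c.
  have normcl : convex_lipschitz (fun y : X => `|y|).
    split => [s t y z s0 t0 st1|].
      by rewrite (le_trans (ler_normD _ _))// !normrZ !ger0_norm.
    by exists 1 => // y z; rewrite mul1r; exact: ler_dist_dist.
  pose d i := if i == m0 then w i else 0.
  have dC m : `|d m| <= C * 2^-1 ^+ m.
    by rewrite /d; case: ifP => // _; rewrite normr0 (le_trans _ (wC m)).
  have dw m : d m = w m \/ d m = 0 by rewrite /d; case: ifP; [left|right].
  have := lim_block_sum_mono dC wC x1 xnullU dw normcl.
  rewrite (lim_block_sum_delta _ _ Uge x1 normcl).
  have -> : (fun k => `|w m0 *: x m0 k|) = (fun=> `|w m0|).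
    by apply/funext => k; rewrite normrZ xm0 mulr1.
  by rewrite lim_cst// => /(_ UU) h; apply: lt_le_trans h; rewrite normr_gt0.
have cn0 : c != 0 by rewrite gt_eqF.
pose vn l := `|v l|^-1 *: v l.
have c20 : 0 < c / 2 by rewrite divr_gt0.
have Lc : L [set l | c / 2 <= `|v l|].
  move/cvgrPdist_le : cn => /(_ _ c20); apply: filterS => l /=.
  rewrite ler_norml => /andP[_]; lra.
have vn1 l : v l != 0 -> `|vn l| = 1.
  by move=> vl; rewrite normrZ normfV normr_id mulVf// normr_eq0.
have vn_le1 l : `|vn l| <= 1.
  have [v0|/vn1 ->//] := eqVneq (v l) 0.
  by rewrite /vn v0 scaler0 normr0.
have v_neq0 l : c / 2 <= `|v l| -> v l != 0.
  by move=> h; rewrite -normr_gt0 (lt_le_trans c20).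
have L1 : L [set l | `|vn l| = 1] by apply: filterS Lc => l /= /v_neq0 /vn1.
have vnull : weakly_null_along L v := block_weakly_null_along wC.
have small f l (e : R) : is_linear_functional f -> c / 2 <= `|v l| ->
    `|f (v l)| <= e * (c / 2) -> `|f (vn l)| <= e.
  move=> flin vl fv.
  rewrite linear_functionalZ//.
  have vl0 : 0 < `|v l| by exact: lt_le_trans vl.
  rewrite normrM normfV normr_id ler_pdivrMl// mulrC.
  apply: (le_trans fv); rewrite ler_wpM2l//.
  by have := le_trans (normr_ge0 _) fv; rewrite pmulr_lge0.
have vnnull : weakly_null_along L vn.
  move=> f flin fcont; apply/cvgrPdist_le => e e0.
  have ec0 : 0 < e * (c / 2) by rewrite mulr_gt0.
  move/cvgrPdist_le : (vnull f flin fcont) => /(_ _ ec0) Le.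
  apply: filterS (filterI Le Lc) => l /= []; rewrite !sub0r !normrN => fv vl.
  exact: small fv.
(* Entries at least [p] make the extracted blocks weakly null; the lower bound on the norm lets this
   survive normalization. *)
have LS p : L [set l | all (leq p) l /\ c / 2 <= `|v l|].
  by apply: filterI => //; exact: (list_filter_all (Uge p)).
have [s [Ss [Z [y [gen yE]]]]] := spreading_model_extraction vn_le1 L1 vnnull LS.
exists Z, y; split.
  exists (fun p => vn (s p)); split => // f flin fcont.
  apply/cvgrPdist_le => e e0.
  have ec0 : 0 < e * (c / 2) by rewrite mulr_gt0.
  have [K KP] := block_sum_functional_small flin fcont wC x1 xnull ec0.
  exists K => // p /= Kp; rewrite sub0r normrN.
  have [sp vsp] := Ss p; apply: small => //; apply: KP.
  by apply: sub_all sp => i; exact: leq_trans.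
exists c^-1; first by rewrite invr_gt0.
move=> a; rewrite yE.
have -> : c^-1 = `|c^-1| by rewrite gtr0_norm// invr_gt0.
rewrite -(model_norm_scale c^-1 _ _ UL vB).
have sB l : `|c^-1 *: v l| <= `|c^-1| * (2 * C) by rewrite normrZ ler_wpM2l.
have close : (fun l => `|vn l - c^-1 *: v l|) @ L --> (0 : R).
  have cd : (fun l => 1 - c^-1 * `|v l|) @ L --> 1 - c^-1 * c.
    by apply: cvgB; [exact: cvg_cst|apply: cvgM; [exact: cvg_cst|]].
  rewrite mulVf// subrr in cd.
  apply/cvgrPdist_le => e e0; move/cvgrPdist_le : cd => /(_ _ e0).
  apply: filterS => l; rewrite !sub0r !normrN normr_id; apply: le_trans.
  have [v0|v0] := eqVneq (v l) 0; first by rewrite /vn v0 !scaler0 subrr normr0.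
  have -> : 1 - c^-1 * `|v l| = (`|v l|^-1 - c^-1) * `|v l|.
    by rewrite mulrBl mulVf ?normr_eq0.
  by rewrite /vn -scalerBl normrZ normrM normr_id.
apply/eqP; rewrite eq_le; apply/andP; split.
  apply: (model_norm_le_comparison _ _ UL UL vn_le1 sB) => G Gcl.
  by rewrite (lim_lipschitz_eq UL sB close Gcl).
apply: (model_norm_le_comparison _ _ UL UL sB vn_le1) => G Gcl.
by rewrite (lim_lipschitz_eq UL sB close Gcl).
Qed.

End block_model.

(** * The strictly increasing sequence *)

Lemma sum_half_le (R : realType) n : \sum_(m < n) (2^-1 : R) ^+ m <= 2.
Proof.
suff : \sum_(m < n) (2^-1 : R) ^+ m = 2 - 2 * 2^-1 ^+ n.
  by move=> ->; rewrite lerBlDr lerDl mulr_ge0// exprn_ge0// invr_ge0.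
elim: n => [|n IH]; first by rewrite big_ord0 expr0 mulr1 subrr.
by rewrite big_ord_recr /= IH exprS; lra.
Qed.

Lemma R_norm_unbounded_witness (R : realType) (I : Type) (Y : I -> completeNormedModType R)
    (xt : forall alpha : I, nat -> Y alpha) (F : set I) (M : R) :
  ~ (exists C : R, forall a : seq R,
      (R_norm xt [set: I] a <= C%:E * R_norm xt F a)%E) -> 0 <= M ->
  exists (alpha : I) (a : seq R), forall beta, F beta ->
    M * `|comb (xt beta) a| < `|comb (xt alpha) a|.
Proof.
move=> nC M0; have /existsNP[a /negP] : ~ forall a : seq R,
    (R_norm xt [set: I] a <= M%:E * R_norm xt F a)%E.
  by move=> h; apply: nC; exists M.
rewrite -ltNge => /ereal_sup_gt[_ [alpha _ <-] h].
exists alpha, a => beta Fb; rewrite -lte_fin EFinM; apply: le_lt_trans h.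
by apply: lee_wpmul2l; [rewrite lee_fin|apply: ereal_sup_ubound; exists beta].
Qed.

Section witness_sequence.
Context {R : realType} {I : Type} {Y : I -> completeNormedModType R}.
Variables (xt : forall alpha : I, nat -> Y alpha) (alpha0 : I).
Hypothesis witness : forall (F : set I) (M : R), finite_set F -> F !=set0 -> 0 <= M ->
  exists (alpha : I) (a : seq R), forall beta, F beta ->
    M * `|comb (xt beta) a| < `|comb (xt alpha) a|.

(* The next weight only depends on the length of the current witness: the l1 norm
   of a list is at most its length times any of the spreading model norms. *)
Lemma exists_witness_sequence :
  exists (alpha : nat -> I) (a : nat -> seq R) (w : nat -> R),
  [/\ w 0%N = 1, forall n, 0 < w n,
      forall n, w n.+1 = w n / (2 * (size (a n)).+1%:R),
      forall n, n%:R / w n * `|comb (xt alpha0) (a n)| < `|comb (xt (alpha n)) (a n)| &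
      forall m n, (m < n)%N ->
        n%:R / w n * `|comb (xt (alpha m)) (a n)| < `|comb (xt (alpha n)) (a n)|].
Proof.
(* [f] is made total by a dummy value where the hypotheses on the state fail. *)
have /choice[f fP] : forall st : set I * R, exists p : I * seq R,
    finite_set st.1 -> st.1 !=set0 -> 0 <= st.2 -> forall beta, st.1 beta ->
    st.2 * `|comb (xt beta) p.2| < `|comb (xt p.1) p.2|.
  move=> [F M]; have [[finF [F0 M0]]|h] :=
      pselect (finite_set F /\ (F !=set0 /\ 0 <= M)).
    by have [alpha [a aP]] := witness finF F0 M0; exists (alpha, a).
  by exists (alpha0, [::]) => ? ? ?; exfalso; apply: h.
pose pick (n : nat) (st : set I * R) := f (st.1, n%:R / st.2).
(* The state records the indices used so far and the current weight. Starting from [alpha0] keeps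
   the set of indices non-empty. *)
pose next (n : nat) (st : set I * R) :=
  (st.1 `|` [set (pick n st).1], st.2 / (2 * (size (pick n st).2).+1%:R)).
pose st n := iteri n next ([set alpha0], 1).
have wgt0 n : 0 < (st n).2 by elim: n => [|n IH] //=; rewrite divr_gt0.
have finF n : finite_set (st n).1.
  elim: n => [|n IH]; first exact: finite_set1.
  by rewrite /= finite_setU; split => //; exact: finite_set1.
have F0 n : (st n).1 alpha0 by elim: n => [//|n IH]; left.
have Fm m n : (m < n)%N -> (st n).1 (pick m (st m)).1.
  elim: n => [//|n IH]; rewrite ltnS leq_eqVlt => /predU1P[->|/IH]; first by right.
  by left.
have Hn n beta : (st n).1 beta -> n%:R / (st n).2 * `|comb (xt beta) (pick n (st n)).2|
    < `|comb (xt (pick n (st n)).1) (pick n (st n)).2|.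
  apply: (fP ((st n).1, n%:R / (st n).2)) => //=; first by exists alpha0.
  by rewrite divr_ge0// ltW.
exists (fun n => (pick n (st n)).1), (fun n => (pick n (st n)).2), (fun n => (st n).2).
by split => // [n|m n mn]; apply: Hn => //; exact: Fm.
Qed.

End witness_sequence.

(** The 2-adic valuation of [n.+1] splits the integers into infinitely many infinite classes, which
    serve as the successive differences of the index sets. *)
Lemma logn_infinite (k j : nat) : exists2 n, (j <= n)%N & logn 2 n.+1 = k.
Proof.
exists (2 ^ k * j.*2.+1).-1.
  rewrite -ltnS prednK ?muln_gt0 ?expn_gt0//.
  by rewrite (leq_trans _ (leq_pmull _ _)) ?expn_gt0// ltnS -addnn leq_addr.
rewrite prednK ?muln_gt0 ?expn_gt0// lognM ?expn_gt0// pfactorK//.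
by rewrite lognE /= dvdn2 /= odd_double /= addn0.
Qed.

Theorem theorem1p4 (R : realType) (X : completeNormedModType R)
  (I : Type) (Y : I -> completeNormedModType R)
  (xt : forall alpha : I, nat -> Y alpha) :
  separable X ->
  infinite_dimensional X ->
  infinite_set [set: I] ->
  (forall alpha : I, weakly_null_spreading_model X (xt alpha)) ->
  (forall F : set I, finite_set F -> F !=set0 ->
     ~ exists C : R, forall a : seq R,
         (R_norm xt [set: I] a <= C%:E * R_norm xt F a)%E) ->
  exists (Z : nat -> completeNormedModType R) (y : forall k : nat, nat -> Z k),
    (forall k, weakly_null_spreading_model X (y k)) /\
    (forall k, sp_lt (y k) (y k.+1)).
Proof.
move=> _ _ infI spI unb.
have [alpha0 _] : [set: I] !=set0.
  by apply/set0P; apply/eqP => I0; apply: infI; rewrite I0; exact: finite_set0.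
have [|alpha [a [w [w0 wgt0 wS ha0 ha]]]] := exists_witness_sequence (xt := xt) alpha0.
  by move=> F M finF F0; exact: (R_norm_unbounded_witness (unb F finF F0)).
have [U [UU Uge]] := nat_ultra.
have /choice[x xP] := spI.
have xnull al : weakly_null (x al) by have [] := xP al.
have gen al : generates_spreading_model (x al) (xt al) by have [] := xP al.
have xn al k : `|x al k| = 1 by have [] := gen al.
have x1 al k : `|x al k| <= 1 by rewrite xn.
have normE al (b : seq R) : model_norm U (x al) (size b) (nth 0 b) = `|comb (xt al) b|.
  exact: model_norm_spreading_model.
have coef al (b : seq R) i : (i < size b)%N -> `|b`_i| <= `|comb (xt al) b|.
  move=> ib; rewrite -normE; apply: coef_le_model_norm => //.
    by apply: filterE => k; exact: xn.
  exact: weakly_null_along_ultra.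
have wadd n m : w (n + m)%N <= w n * 2^-1 ^+ m.
  elim: m => [|m IH]; first by rewrite addn0 expr0 mulr1.
  rewrite addnS wS exprSr mulrA; apply: ler_pM => //; first exact: ltW.
  by rewrite lef_pV2 ?posrE ?mulr_gt0// ler_pMr// ler1n.
(* The k-th index set consists of the [m] whose successor has 2-adic valuation at most [k]. It
   always contains 0, where the weight is 1, so the blocks do not degenerate. *)
pose om k m := if (logn 2 m.+1 <= k)%N then w m else 0.
have wC m : `|w m| <= 1 * 2^-1 ^+ m.
  by rewrite gtr0_norm//; have := wadd 0%N m; rewrite add0n w0.
have omC k m : `|om k m| <= 1 * 2^-1 ^+ m.
  by rewrite /om; case: ifP => // _; rewrite normr0 (le_trans _ (wC m)).
pose xs m := x (alpha m).
pose rho k := model_norm (list_filter U) (block_sum (om k) xs).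
have /choice[Zy ZyP] : forall k, exists Zy : {Z : completeNormedModType R & nat -> Z},
    weakly_null_spreading_model X (projT2 Zy) /\
    exists2 c : R, 0 < c & forall b : seq R,
      `|comb (projT2 Zy) b| = c * rho k (size b) (nth 0 b).
  move=> k.
  have [|Z [y yP]] := block_spreading_model (m0 := 0%N) (x := xs) Uge
      (fun m => x1 _) (fun m => xnull _) (omC k) (fun k => xn _ k).
    by rewrite /om logn1 /= w0 oner_eq0.
  by exists (existT _ Z y).
exists (fun k => projT1 (Zy k)), (fun k => projT2 (Zy k)); split => [k|k].
  by have [] := ZyP k.
have [_ [c c0 cE]] := ZyP k; have [_ [c' c'0 cE']] := ZyP k.+1.
have xsnull m : weakly_null (xs m) by exact: xnull.
have xs1 m j : `|xs m j| <= 1 by exact: x1.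
have rho0 l n b : 0 <= rho l n b.
  have UL : UltraFilter (list_filter U) by exact: list_filter_ultra.
  exact: (model_norm_ge0 (fun j => block_sum_le j (omC l) xs1)).
split.
  exists (c / c') => b; rewrite cE cE' mulrA divfK ?gt_eqF// ler_pM2l//.
  apply: (block_model_mono Uge xs1 xsnull _ _ (omC k) (omC k.+1)) => m.
  by rewrite /om; case: ifP => h; [left; rewrite leqW|right].
move=> [C HC].
(* The estimates below turn domination with constant [C] into [n <= 3 * |C| * c / c'], whence the
   threshold. *)
have [j jP] : exists j : nat, 3 * `|C| * c / c' < j%:R.
  exists (Num.bound (3 * `|C| * c / c')); apply: archi_boundP.
  by rewrite divr_ge0 ?mulr_ge0// ltW.
have [n jn logn_n] := logn_infinite k.+1 j.
have n0 : (0 < n)%N by case: (n) logn_n => //; rewrite logn1.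
set b := a n; set r := `|comb (xt (alpha n)) b|.
have n0R : 0 < n%:R :> R by rewrite ltr0n.
(* By the choice of the witness, [q] bounds the norm of [b] in the model of [alpha0] and in those of
   all [alpha m] with [m < n]. *)
pose q := w n * r / n%:R.
have lt_q (t : R) : n%:R / w n * t < r -> t <= q.
  move=> h; apply: ltW; rewrite /q ltr_pdivlMr// mulrC.
  by move: h; rewrite mulrAC ltr_pdivrMr// [r * _]mulrC.
have r0 : 0 < r.
  by apply: le_lt_trans (ha0 n); rewrite mulr_ge0// divr_ge0// ltW.
have q0 : 0 <= q by rewrite divr_ge0// mulr_ge0// ltW.
have rho_ge : w n * r <= rho k.+1 (size b) (nth 0 b).
  pose d m := if m == n then w m else 0.
  have dC m : `|d m| <= 1 * 2^-1 ^+ m.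
    by rewrite /d; case: ifP => // _; rewrite normr0 (le_trans _ (wC m)).
  have := block_model_delta Uge xs1 w n (size b) (nth 0 b).
  rewrite normE gtr0_norm// -/r => <-.
  apply: (block_model_mono Uge xs1 xsnull _ _ dC (omC k.+1)) => m.
  rewrite /d /om; case: eqP => [->|_]; last by right.
  by left; rewrite logn_n leqnn.
(* The weights before [n] sum to at most 2 and give [2 * q]; the weight at [n] vanishes since [n] is
   not in the k-th set; the later weights give at most [q]. *)
have rho_le : rho k (size b) (nth 0 b) <= 3 * q.
  have tailT m : `|om k (n.+1 + m)%N| <= w n.+1 * 2^-1 ^+ m.
    rewrite /om; case: ifP => _; last first.
      by rewrite normr0 mulr_ge0 ?exprn_ge0 ?invr_ge0// ltW.
    by rewrite gtr0_norm.
  apply: (le_trans (block_model_le Uge xs1 (size b) (nth 0 b) (omC k) tailT)).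
  have -> : 3 * q = 2 * q + q by lra.
  apply: lerD.
    rewrite big_ord_recr /= {2}/om logn_n ltnn normr0 mul0r addr0.
    apply: (@le_trans _ _ (\sum_(m < n) 2^-1 ^+ m * q)).
      apply: ler_sum => m _; rewrite normE; apply: ler_pM => //.
        by have := omC k m; rewrite mul1r.
      exact/lt_q/ha.
    by rewrite -mulr_suml ler_wpM2r// sum_half_le.
  apply: (@le_trans _ _ (2 * w n.+1 * ((size b).+1%:R * q))).
    rewrite ler_wpM2l ?mulr_ge0 ?(ltW (wgt0 _))//.
    apply: (@le_trans _ _ (\sum_(i < size b) q)).
      by apply: ler_sum => i _; rewrite (le_trans (coef alpha0 _ _ (ltn_ord i)))//; exact: lt_q.
    by rewrite sumr_const card_ord -[q *+ _]mulr_natl ler_wpM2r// ler_nat.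
  (* The divisor [2 * (size b).+1] in the recursion for the weights cancels the length of [b] and
     the factor 2 here, leaving [w n <= 1]. *)
  rewrite wS -/b mulrA -[leRHS]mul1r ler_wpM2r//.
  have -> : 2 * (w n / (2 * (size b).+1%:R)) * (size b).+1%:R = w n.
    by field; rewrite nat1r pnatr_eq0.
  have := wadd 0%N n; rewrite add0n w0 mul1r => /le_trans; apply.
  by rewrite exprn_ile1// ?invr_ge0// invf_le1// ler1n.
have : c' * (w n * r) <= `|C| * (c * (3 * q)).
  apply: (@le_trans _ _ (c' * rho k.+1 (size b) (nth 0 b))).
    by rewrite ler_pM2l.
  rewrite -cE' (le_trans (HC b))// cE.
  apply: (@le_trans _ _ (`|C| * (c * rho k (size b) (nth 0 b)))).
    by rewrite ler_wpM2r ?ler_norm// mulr_ge0// ltW.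
  by rewrite ler_wpM2l// ler_pM2l.
apply/negP; rewrite -ltNge.
have wr0 : 0 < w n * r by rewrite mulr_gt0.
have -> : `|C| * (c * (3 * q)) = (3 * `|C| * c / n%:R) * (w n * r).
  by rewrite /q; field; rewrite gt_eqF.
rewrite mulrC [ltRHS]mulrC ltr_pM2l// ltr_pdivrMr// [ltRHS]mulrC -ltr_pdivrMr//.
by rewrite (lt_le_trans jP)// ler_nat.
Qed.
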